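(* Let $n\ge 1$ and let $\varphi:\mathbb{C}^n\to\mathbb{C}^n$ be a holomorphic mapping such that the composition operator $C_\varphi$ is bounded on the Fock space $\mathcal{F}^2(\mathbb{C}^n)$. If $C_\varphi$ is hyponormal, then it is normal.
   Context: On $\mathbb{C}^n$ use the inner product $\langle z,w\rangle=\sum_{j=1}^n z_j\overline{w_j}$ and norm $|z|=\sqrt{\langle z,z\rangle}$. The Fock space $\mathcal{F}^2(\mathbb{C}^n)$ is the Hilbert space of all holomorphic functions $f:\mathbb{C}^n\to\mathbb{C}$ with $\|f\|^2=\left(\frac{1}{2\pi}\right)^n\int_{\mathbb{C}^n}|f(z)|^2e^{-|z|^2/2}\,dv(z)<\infty$, where $dv$ is Lebesgue volume measure on $\mathbb{C}^n$. The composition operator is $C_\varphi f=f\circ\varphi$; it is called bounded if it maps $\mathcal{F}^2(\mathbb{C}^n)$ into itself and is a bounded linear operator there. A bounded operator $T$ on a Hilbert space is normal if $T^*T=TT^*$, and hyponormal if $\|Tf\|\ge\|T^*f\|$ for all vectors $f$. *)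

(* Defs.v *)
From HB Require Import structures.
From mathcomp Require Import all_boot all_order all_algebra.
From mathcomp Require Import complex.
From mathcomp Require Import all_classical all_reals all_analysis.

Set Implicit Arguments.
Unset Strict Implicit.
Unset Printing Implicit Defensive.

Import Order.TTheory GRing.Theory Num.Theory.
Import numFieldNormedType.Exports.
Import Normc.

Local Open Scope classical_set_scope.
Local Open Scope ring_scope.
Local Open Scope complex_scope.

(** The library's canonical sigma-finite structure on [m1 \x m2] is shadowed by
    the one for subprobabilities, hence this copy. *)

Section sigma_finite_product.
Context d1 d2 (T1 : measurableType d1) (T2 : measurableType d2) (R : realType).
Variables (m1 : {sigma_finite_measure set T1 -> \bar R})
          (m2 : {sigma_finite_measure set T2 -> \bar R}).

Definition sigma_finite_product : set (T1 * T2)%type -> \bar R :=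
  (m1 \x m2)%E.

HB.instance Definition _ := Measure.on sigma_finite_product.

Let sigma_finite_productT : sigma_finite setT sigma_finite_product.
Proof.
have /sigma_finiteP[F [TF ndF Foo]] := sigma_finiteT m1.
have /sigma_finiteP[G [TG ndG Goo]] := sigma_finiteT m2.
exists (fun n => F n `*` G n).
  rewrite -setXTT TF TG predeqE => -[x y]; split.
    move=> [/= [n _ Fnx] [k _ Gky]]; exists (maxn n k) => //; split.
    - by move: x Fnx; exact/subsetPset/ndF/leq_maxl.
    - by move: y Gky; exact/subsetPset/ndG/leq_maxr.
  by move=> [n _ []/= ? ?]; split; exists n.
move=> k; have [? ?] := Foo k; have [? ?] := Goo k.
split; first exact: measurableX.
rewrite /sigma_finite_product product_measure1E// lte_mul_pinfty//.
by rewrite ge0_fin_numE.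
Qed.

HB.instance Definition _ := Measure_isSigmaFinite.Build _ _ _
  sigma_finite_product sigma_finite_productT.

End sigma_finite_product.

(** The library puts a topology on [R[i]^o] only, not on [R[i]] itself. *)
HB.instance Definition _ (R : realType) := NormedModule.copy R[i] R[i]^o.

(** Finite powers of a sigma-finite measure, on the product sigma-algebra of
    [n.-tuple T] (the one generated by the coordinate maps). *)

Section power_measure.
Context d (T : measurableType d) (R : realType).
Variable mu : {sigma_finite_measure set T -> \bar R}.

Definition consT n (x : n.-tuple T * T) : n.+1.-tuple T :=
  [the n.+1.-tuple T of x.2 :: x.1].

Lemma measurable_consT n : measurable_fun setT (@consT n).
Proof. exact: measurable_cons measurable_snd measurable_fst. Qed.

Definition measure_consT n (nu : {measure set (n.-tuple T) -> \bar R}) :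
    set (n.+1.-tuple T) -> \bar R :=
  pushforward (nu \x mu)%E (@consT n).

Section measure_consT.
Variables (n : nat) (nu : {measure set (n.-tuple T) -> \bar R}).
Let m := measure_consT nu.
Let mc := @measurable_consT n.

Let m0 : m set0 = 0%E. Proof. exact: measure0. Qed.

Let m_ge0 A : (0 <= m A)%E. Proof. exact: measure_ge0. Qed.

Let m_sigma_additive : semi_sigma_additive m.
Proof. exact: measure_semi_sigma_additive. Qed.

HB.instance Definition _ := isMeasure.Build _ _ _ (measure_consT nu)
  m0 m_ge0 m_sigma_additive.

End measure_consT.

Fixpoint power_measure n : {measure set (n.-tuple T) -> \bar R} :=
  if n is m.+1 then measure_consT (power_measure m)
  else \d_([tuple] : 0.-tuple T).

End power_measure.

Section fock.
Variables (R : realType) (n : nat).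
Local Notation C := R[i].
Local Notation Cn := 'rV[R[i]]_n.

Definition csqnorm (z : Cn) : R := \sum_(j < n) (normc (z ord0 j)) ^+ 2.

(** A point of C^n is integrated over through its real coordinates
    ((x_1, y_1), ..., (x_n, y_n)), with z_j = x_j + i y_j. *)

Local Notation plane := (measurableTypeR R * measurableTypeR R)%type.

Definition lebesgue_plane : {sigma_finite_measure set plane -> \bar R} :=
  sigma_finite_product lebesgue_measure lebesgue_measure.

Definition volume : {measure set (n.-tuple plane) -> \bar R} :=
  power_measure lebesgue_plane n.

Definition complex_point (t : n.-tuple plane) : Cn :=
  \row_j ((tnth t j).1 +i* (tnth t j).2).

(** [differentiable] is Frechet differentiability over the base field of the
    normed modules, here R[i]. *)

Definition holomorphic (f : Cn -> C) :=
  forall z : Cn, differentiable f z.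

Definition holomorphic_map (phi : Cn -> Cn) :=
  forall z : Cn, differentiable phi z.

Definition gaussian (z : Cn) : R := expR (- (csqnorm z / 2)).

Definition fock_const : R := ((2 * pi)^-1) ^+ n.

Definition fock_esqnorm (f : Cn -> C) : \bar R :=
  (fock_const%:E * \int[volume]_t
     ((normc (f (complex_point t)) ^+ 2 * gaussian (complex_point t))%:E))%E.

Definition fock : set (Cn -> C) :=
  [set f | holomorphic f /\ (fock_esqnorm f < +oo)%E].

Definition fock_norm (f : Cn -> C) : R := Num.sqrt (fine (fock_esqnorm f)).

Definition fock_dot (f g : Cn -> C) : C :=
  let h t := f (complex_point t) * conjc (g (complex_point t)) in
  (fock_const * \int[volume]_t (complex.Re (h t) * gaussian (complex_point t))) +i*
  (fock_const * \int[volume]_t (complex.Im (h t) * gaussian (complex_point t))).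

(** Operators on the Fock space are maps on all functions C^n -> C, of which
    only the restriction to [fock] is meaningful. *)

Definition bounded_on_fock (T : (Cn -> C) -> (Cn -> C)) :=
  [/\ forall f, fock f -> fock (T f),
      forall (a : C) f g, fock f -> fock g ->
        T (fun z => a * f z + g z) = (fun z => a * T f z + T g z)
    & exists M : R, forall f, fock f -> fock_norm (T f) <= M * fock_norm f].

Definition is_adjoint (T S : (Cn -> C) -> (Cn -> C)) :=
  (forall f, fock f -> fock (S f)) /\
  (forall f g, fock f -> fock g -> fock_dot (T f) g = fock_dot f (S g)).

(** The adjoint of a bounded operator exists (Riesz) and is unique on [fock],
    so the existential quantifiers below just name T^*. *)

Definition normal_on_fock (T : (Cn -> C) -> (Cn -> C)) :=
  exists2 S, is_adjoint T S & forall f, fock f -> S (T f) = T (S f).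

Definition hyponormal_on_fock (T : (Cn -> C) -> (Cn -> C)) :=
  exists2 S, is_adjoint T S &
    forall f, fock f -> fock_norm (S f) <= fock_norm (T f).

Definition composition (phi : Cn -> Cn) (f : Cn -> C) : Cn -> C := f \o phi.

End fock.

(* Main.v *)
From HB Require Import structures.
From mathcomp Require Import all_boot all_order all_algebra.
From mathcomp Require Import complex ring lra.
From mathcomp Require Import all_classical all_reals all_analysis.
From mathcomp Require Import measurable_realfun.
Require Import Defs.

(** Point evaluation at w on the Fock space is the inner product with the kernel
    K_w (z) = exp (<z, w> / 2), whose norm is exp (|w|^2 / 4). Hence the adjoint S of
    C_phi acts on kernels by S K_w = K_(phi w), and everything can be read off from
    the kernels. As C_phi fixes K_0 = 1, hyponormality at K_0 forces phi 0 = 0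
    ([phi_zero]). Hyponormality and boundedness together give
    |phi w|^2 <= |w|^2 + c ([phi_growth]), so that phi is linear by Liouville,
    phi z = z A on row vectors ([phi_linear]). Write B for the
    conjugate transpose of A. Then C_phi K_w = K_(w B), and
    hyponormality on kernels says |w A| <= |w B| for all w. Both sides have the same
    sum of squares over the standard basis, so equality of traces upgrades the
    inequality to A B = B A ([normal_of_csqnorm_le]). Finally S f (w) = f (w B) for
    every f, so S and C_phi are compositions with two commuting linear maps.

    The analytic input is the reproducing formula. In one variable
    ([reproducing_plane]) it is obtained without Cauchy's theory of contour
    integrals: up to a constant, (g - g w) times the Gaussian kernel is the
    conjugate derivative of the difference quotient of g at w times this kernel, so
    its integral over the plane vanishes by the divergence theorem. The latter is
    proved for fields that are only Frechet differentiable, by Goursat's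
    subdivision ([divergence_rect]); a point where the field is only continuous is
    cut out, and the boundary at infinity disappears along well chosen rectangles
    ([divergence_plane]). Fubini's theorem extends the formula to several variables
    ([reproducing_row]). Liouville's theorem is in turn a consequence of the formula:
    applied to z |-> g (r z) with r tending to infinity, it gives g (2w) = 2 g (w) for
    g of linear growth vanishing at 0 ([liouville_double]). *)

Set Implicit Arguments.
Unset Strict Implicit.
Unset Printing Implicit Defensive.

Import Order.TTheory GRing.Theory Num.Theory.
Import numFieldNormedType.Exports.
Import Normc.

Local Open Scope classical_set_scope.
Local Open Scope ring_scope.
Local Open Scope complex_scope.

(** * Integrals of real functions *)

Section real_integrals.
Context d (T : measurableType d) (R : realType).
Variable mu : {measure set T -> \bar R}.
Implicit Types (D : set T) (f g : T -> R).

Lemma integrable_addR D f g : measurable D ->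
  mu.-integrable D (EFin \o f) -> mu.-integrable D (EFin \o g) ->
  mu.-integrable D (EFin \o (fun x => f x + g x)).
Proof. by move=> mD fi gi; have := integrableD mD fi gi; exact: eq_integrable. Qed.

Lemma integrable_subR D f g : measurable D ->
  mu.-integrable D (EFin \o f) -> mu.-integrable D (EFin \o g) ->
  mu.-integrable D (EFin \o (fun x => f x - g x)).
Proof. by move=> mD fi gi; have := integrableB mD fi gi; exact: eq_integrable. Qed.

Lemma integrable_scaleR D (k : R) f : measurable D ->
  mu.-integrable D (EFin \o f) -> mu.-integrable D (EFin \o (fun x => k * f x)).
Proof. by move=> mD fi; have := integrableZl mD k fi; exact: eq_integrable. Qed.

Lemma le_integrableR D f g : measurable D -> measurable_fun D f ->
  (forall x, D x -> `|f x| <= g x) -> mu.-integrable D (EFin \o g) ->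
  mu.-integrable D (EFin \o f).
Proof.
move=> mD mf fg; apply: le_integrable => //; first exact/measurable_EFinP.
by move=> x Dx /=; rewrite lee_fin (le_trans (fg x Dx))// ler_norm.
Qed.

Lemma integrable_cstR D (k : R) : measurable D -> (mu D < +oo)%E ->
  mu.-integrable D (EFin \o (fun=> k)).
Proof.
move=> mD muD; apply: measurable_bounded_integrable => //.
exact: bounded_cst.
Qed.

Lemma Rintegral_near_cst D f (k e : R) :
  measurable D -> (mu D < +oo)%E -> mu.-integrable D (EFin \o f) ->
  (forall x, D x -> `|f x - k| <= e) ->
  `|\int[mu]_(x in D) f x - k * fine (mu D)| <= e * fine (mu D).
Proof.
move=> mD muD fi fk.
have ki c : mu.-integrable D (EFin \o (fun=> c : R)) by exact: integrable_cstR.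
have fki := integrable_subR mD fi (ki k).
rewrite -!Rintegral_cst// -RintegralB//; apply: le_trans.
  exact: le_normr_Rintegral.
by apply: le_Rintegral => //; exact: integrable_norm.
Qed.

End real_integrals.

(** * The divergence theorem on rectangles, after Goursat *)

Section divergence.
Variable R : realType.
Notation mu := (@lebesgue_measure R).
Notation lam := (lebesgue_plane R).
Notation plane := (measurableTypeR R * measurableTypeR R)%type.

Definition rect (a b c d : R) : set plane := `]a, b] `*` `]c, d].

Lemma measurable_rect a b c d : measurable (rect a b c d).
Proof. by apply: measurableX; exact: measurable_itv. Qed.

Lemma lebesgue_plane_rect a b c d : a <= b -> c <= d ->
  lam (rect a b c d) = ((b - a) * (d - c))%:E.
Proof.
move=> ab cd.
have -> : lam (rect a b c d) = (mu \x mu)%E (rect a b c d) by [].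
rewrite product_measure1E//=.
have E x y : x <= y -> mu `]x, y] = (y - x)%:E.
  move=> xy; rewrite lebesgue_measure_itv/= lte_fin.
  by case: ltgtP xy => // -> _; rewrite subrr.
by rewrite !E// EFinM.
Qed.

Lemma fine_lebesgue_itv (a b : R) : a <= b -> fine (mu `]a, b]) = b - a.
Proof.
move=> ab; rewrite lebesgue_measure_itv/= lte_fin.
by case: ltgtP ab => // -> _; rewrite subrr.
Qed.

Lemma lebesgue_itv_lty (a b : R) : (mu `]a, b] < +oo)%E.
Proof. by rewrite lebesgue_measure_itv/=; case: ifP => // _; rewrite ltry. Qed.

Lemma continuous_integrable_itv (f : R -> R) (a b : R) :
  continuous f -> mu.-integrable `]a, b] (EFin \o f).
Proof.
move=> cf; have H : mu.-integrable `[a, b] (EFin \o f).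
  apply: continuous_compact_integrable; first exact: segment_compact.
  exact: continuous_subspaceT.
apply: integrableS H; try exact: measurable_itv.
by move=> x /=; rewrite !in_itv/= => /andP[/ltW -> ->].
Qed.

Lemma Rintegral_itv_split (f : R -> R) (a m b : R) : continuous f ->
  a <= m -> m <= b ->
  \int[mu]_(x in `]a, b]) f x =
  \int[mu]_(x in `]a, m]) f x + \int[mu]_(x in `]m, b]) f x.
Proof.
move=> cf am mb.
have -> : `]a, b]%classic = `]a, m]%classic `|` `]m, b]%classic.
  by rewrite -itv_bndbnd_setU// bnd_simp.
apply: Rintegral_setU; try exact: measurable_itv.
  by rewrite -itv_bndbnd_setU ?bnd_simp//; exact: continuous_integrable_itv.
apply/disj_setPS => x [/=]; rewrite !in_itv/= => /andP[_ xm] /andP[+ _].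
by rewrite ltNge xm.
Qed.

Variables (P Q : R -> R -> R) (G : plane -> R).
Hypothesis P_cont : forall x, continuous (P x).
Hypothesis Q_cont : forall y, continuous (Q ^~ y).
Hypothesis G_int : lam.-integrable setT (EFin \o G).

(** Outward flux of the field (P, Q) through the boundary of the rectangle, minus
    the integral of G inside. Half-open intervals make the pieces of a subdivided
    rectangle disjoint, so that the defect is exactly additive. *)
Definition flux_defect (a b c d : R) : R :=
  \int[mu]_(y in `]c, d]) (P b y - P a y) +
  \int[mu]_(x in `]a, b]) (Q x d - Q x c) -
  \int[lam]_(z in rect a b c d) G z.

Let G_rect a b c d : lam.-integrable (rect a b c d) (EFin \o G).
Proof.
by apply: integrableS G_int => //; exact: measurable_rect.
Qed.

Let P_int x a b : mu.-integrable `]a, b] (EFin \o P x).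
Proof. exact: continuous_integrable_itv. Qed.

Let Q_int y a b : mu.-integrable `]a, b] (EFin \o (Q ^~ y)).
Proof. exact: continuous_integrable_itv. Qed.

Lemma flux_defect_splitx a m b c d : a <= m -> m <= b ->
  flux_defect a b c d = flux_defect a m c d + flux_defect m b c d.
Proof.
move=> am mb; rewrite /flux_defect.
have -> : rect a b c d = rect a m c d `|` rect m b c d.
  rewrite /rect (@itv_bndbnd_setU _ _ _ (BRight m)) ?bnd_simp//.
  by apply/seteqP; split=> -[x y] /=; tauto.
rewrite (@Rintegral_itv_split (fun x => Q x d - Q x c) a m b)//; last first.
  by move=> x; apply: cvgB; exact: Q_cont.
rewrite Rintegral_setU; [|exact: measurable_rect|exact: measurable_rect| |].
- rewrite !RintegralB//; try exact: measurable_itv.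
  by ring.
- by apply: integrableS G_int => //; apply: measurableU; exact: measurable_rect.
- apply/disj_setPS => -[x y] [[/= + _] [/= + _]].
  by rewrite !in_itv/= => /andP[_ xm] /andP[+ _]; rewrite ltNge xm.
Qed.

Lemma flux_defect_splity a b c m d : c <= m -> m <= d ->
  flux_defect a b c d = flux_defect a b c m + flux_defect a b m d.
Proof.
move=> cm md; rewrite /flux_defect.
have -> : rect a b c d = rect a b c m `|` rect a b m d.
  rewrite /rect (@itv_bndbnd_setU _ _ (BRight c) (BRight m)) ?bnd_simp//.
  by apply/seteqP; split=> -[x y] /=; tauto.
rewrite (@Rintegral_itv_split (fun y => P b y - P a y) c m d)//; last first.
  by move=> x; apply: cvgB; exact: P_cont.
rewrite Rintegral_setU; [|exact: measurable_rect|exact: measurable_rect| |].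
- rewrite !RintegralB//; try exact: measurable_itv.
  by ring.
- by apply: integrableS G_int => //; apply: measurableU; exact: measurable_rect.
- apply/disj_setPS => -[x y] [[/= _ +] [/= _ +]].
  by rewrite !in_itv/= => /andP[_ xm] /andP[+ _]; rewrite ltNge xm.
Qed.

(** P and Q are only Frechet differentiable, with no continuity of their partial
    derivatives: this is all that complex differentiability provides, and it is
    the reason for Goursat's subdivision argument below. *)
Definition has_divergence (p q : R) : Prop :=
  exists Px Py Qx Qy : R, Px + Qy = G (p, q) /\
  forall e, 0 < e -> exists2 r, 0 < r & forall x y, `|x - p| < r -> `|y - q| < r ->
  [/\ `|P x y - P p q - (Px * (x - p) + Py * (y - q))| <= e * (`|x - p| + `|y - q|),
      `|Q x y - Q p q - (Qx * (x - p) + Qy * (y - q))| <= e * (`|x - p| + `|y - q|)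
    & `|G (x, y) - G (p, q)| <= e].

(** The affine parts of P and Q contribute exactly G (p, q) times the area. The
    remainders are small compared with the diameter and are integrated along
    sides, hence an error small compared with the square of the size. *)
Lemma flux_defect_small p q : has_divergence p q ->
  forall e, 0 < e -> exists2 r, 0 < r & forall a b c d,
    a <= p <= b -> c <= q <= d -> (b - a) + (d - c) < r ->
    `|flux_defect a b c d| <= e * ((b - a) + (d - c)) ^+ 2.
Proof.
move=> [Px [Py [Qx [Qy [divG loc]]]]] e e0.
have e30 : 0 < e / 3 by rewrite divr_gt0.
have [r r0 {}loc] := loc _ e30.
exists r => // a b c d /andP[ap pb] /andP[cq qd] abcd.
have ab : a <= b by exact: le_trans pb.
have cd : c <= d by exact: le_trans qd.
set s := b - a in abcd *; set t := d - c in abcd *.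
have inx x : a <= x <= b -> `|x - p| <= s /\ `|x - p| < r.
  move=> /andP[ax xb]; have : `|x - p| <= s.
    by rewrite ler_norml /s; apply/andP; split; lra.
  by move=> H; split => //; apply: le_lt_trans H _; rewrite /s /t in abcd *; lra.
have iny y : c <= y <= d -> `|y - q| <= t /\ `|y - q| < r.
  move=> /andP[ax xb]; have : `|y - q| <= t.
    by rewrite ler_norml /t; apply/andP; split; lra.
  by move=> H; split => //; apply: le_lt_trans H _; rewrite /s /t in abcd *; lra.
have s0 : 0 <= s by rewrite /s subr_ge0.
have t0 : 0 <= t by rewrite /t subr_ge0.
have itvx x : `]a, b]%classic x -> a <= x <= b.
  by rewrite /= in_itv/= => /andP[/ltW -> ->].
have itvy y : `]c, d]%classic y -> c <= y <= d.
  by rewrite /= in_itv/= => /andP[/ltW -> ->].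
have aab : a <= a <= b by rewrite lexx.
have bab : a <= b <= b by rewrite lexx ab.
have ccd : c <= c <= d by rewrite lexx.
have dcd : c <= d <= d by rewrite lexx cd.
pose h : R := e / 3 * (2 * (s + t)).
have sap : `|a - p| + `|b - p| = s.
  by rewrite ler0_norm ?subr_le0// ger0_norm ?subr_ge0// /s; ring.
have tcq : `|c - q| + `|d - q| = t.
  by rewrite ler0_norm ?subr_le0// ger0_norm ?subr_ge0// /t; ring.
have EP : `|\int[mu]_(y in `]c, d]) (P b y - P a y) - (Px * s) * t| <= h * t.
  have := @Rintegral_near_cst _ _ R mu `]c, d]%classic
    (fun y => P b y - P a y) (Px * s) h.
  rewrite fine_lebesgue_itv// -/t; apply.
  - exact: measurable_itv.
  - exact: lebesgue_itv_lty.
  - by apply: integrable_subR => //; exact: measurable_itv.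
  - move=> y /itvy /iny[yt yr].
    have [_ ar] := inx _ aab; have [_ br] := inx _ bab.
    have [Ha _ _] := loc _ _ ar yr; have [Hb _ _] := loc _ _ br yr.
    have -> : P b y - P a y - Px * s =
      (P b y - P p q - (Px * (b - p) + Py * (y - q))) -
      (P a y - P p q - (Px * (a - p) + Py * (y - q))) by rewrite /s; ring.
    apply: le_trans (ler_normB _ _) _; apply: le_trans (lerD Hb Ha) _.
    rewrite -mulrDr /h ler_wpM2l ?(ltW e30)//; lra.
have EQ : `|\int[mu]_(x in `]a, b]) (Q x d - Q x c) - (Qy * t) * s| <= h * s.
  have := @Rintegral_near_cst _ _ R mu `]a, b]%classic
    (fun x => Q x d - Q x c) (Qy * t) h.
  rewrite fine_lebesgue_itv// -/s; apply.
  - exact: measurable_itv.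
  - exact: lebesgue_itv_lty.
  - by apply: integrable_subR => //; exact: measurable_itv.
  - move=> x /itvx /inx[xs xr].
    have [_ cr] := iny _ ccd; have [_ dr] := iny _ dcd.
    have [_ Hc _] := loc _ _ xr cr; have [_ Hd _] := loc _ _ xr dr.
    have -> : Q x d - Q x c - Qy * t =
      (Q x d - Q p q - (Qx * (x - p) + Qy * (d - q))) -
      (Q x c - Q p q - (Qx * (x - p) + Qy * (c - q))) by rewrite /t; ring.
    apply: le_trans (ler_normB _ _) _; apply: le_trans (lerD Hd Hc) _.
    rewrite -mulrDr /h ler_wpM2l ?(ltW e30)//; lra.
have EG : `|\int[lam]_(z in rect a b c d) G z - G (p, q) * (s * t)|
    <= e / 3 * (s * t).
  have := @Rintegral_near_cst _ _ R lam (rect a b c d) G (G (p, q)) (e / 3).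
  rewrite [fine _](congr1 fine (lebesgue_plane_rect ab cd)); apply => //.
  - exact: measurable_rect.
  - by apply: (@le_lt_trans _ _ (s * t)%:E); rewrite ?ltry// -lebesgue_plane_rect.
  - move=> [x y] [/itvx/inx[_ xr] /itvy/iny[_ yr]].
    by have [] := loc _ _ xr yr.
rewrite /flux_defect.
set I1 := \int[mu]_(y in _) _ in EP *; set I2 := \int[mu]_(x in _) _ in EQ *.
set I3 := \int[lam]_(z in _) _ in EG *.
have -> : I1 + I2 - I3 = (I1 - Px * s * t) + (I2 - Qy * t * s) -
    (I3 - G (p, q) * (s * t)) by rewrite -divG; ring.
apply: le_trans (ler_normB _ _) _.
apply: (@le_trans _ _ ((h * t + h * s) + e / 3 * (s * t))).
  by apply: lerD => //; apply: le_trans (ler_normD _ _) _; exact: lerD.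
rewrite /h.
have -> : e / 3 * (2 * (s + t)) * t + e / 3 * (2 * (s + t)) * s + e / 3 * (s * t) =
  e * (s + t) ^+ 2 - e / 3 * (s ^+ 2 + s * t + t ^+ 2) by field.
rewrite lerBlDr lerDl mulr_ge0 ?(ltW e30)//.
by rewrite !addr_ge0// ?sqr_ge0// mulr_ge0.
Qed.

Lemma flux_defect_quarter a b c d : a <= b -> c <= d ->
  exists r : R * R * R * R,
  [/\ a <= r.1.1.1, r.1.1.1 <= r.1.1.2, r.1.1.2 <= b,
      [/\ c <= r.1.2, r.1.2 <= r.2 & r.2 <= d] &
      r.1.1.2 - r.1.1.1 = (b - a) / 2 /\ r.2 - r.1.2 = (d - c) / 2 /\
      `|flux_defect a b c d| <= 4 * `|flux_defect r.1.1.1 r.1.1.2 r.1.2 r.2|].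
Proof.
move=> ab cd; pose m := (a + b) / 2; pose k := (c + d) / 2.
have am : a <= m by rewrite /m; lra.
have mb : m <= b by rewrite /m; lra.
have ck : c <= k by rewrite /k; lra.
have kd : k <= d by rewrite /k; lra.
have : flux_defect a b c d =
   flux_defect a m c k + flux_defect a m k d +
   (flux_defect m b c k + flux_defect m b k d).
  by rewrite (flux_defect_splitx _ _ am mb) !(flux_defect_splity _ _ ck kd).
set e := flux_defect a b c d.
set e1 := flux_defect a m c k; set e2 := flux_defect a m k d.
set e3 := flux_defect m b c k; set e4 := flux_defect m b k d => eE.
have [H1|H1] := leP `|e| (4 * `|e1|).
  by exists (a, m, c, k); split => //=; split; [|split] => //; rewrite /m /k; lra.
have [H2|H2] := leP `|e| (4 * `|e2|).
  by exists (a, m, k, d); split => //=; split; [|split] => //; rewrite /m /k; lra.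
have [H3|H3] := leP `|e| (4 * `|e3|).
  by exists (m, b, c, k); split => //=; split; [|split] => //; rewrite /m /k; lra.
have [H4|H4] := leP `|e| (4 * `|e4|).
  by exists (m, b, k, d); split => //=; split; [|split] => //; rewrite /m /k; lra.
exfalso.
have : `|e| <= `|e1| + `|e2| + (`|e3| + `|e4|).
  rewrite eE; apply: le_trans (ler_normD _ _) _.
  by apply: lerD; exact: ler_normD.
lra.
Qed.

(** Goursat's argument. Quartering repeatedly, and keeping each time a quarter
    whose defect is at least a quarter of the previous one, gives nested
    rectangles that shrink to a point; there the defect would be of the order of
    the square of the size, against [flux_defect_small]. *)
Lemma divergence_rect a b c d : a <= b -> c <= d ->
  (forall p q, a <= p <= b -> c <= q <= d -> has_divergence p q) ->
  flux_defect a b c d = 0.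
Proof.
move=> ab cd loc.
pose quarter (r' r : R * R * R * R) :=
    [/\ r'.1.1.1 <= r.1.1.1, r.1.1.1 <= r.1.1.2, r.1.1.2 <= r'.1.1.2,
      [/\ r'.1.2 <= r.1.2, r.1.2 <= r.2 & r.2 <= r'.2] &
      r.1.1.2 - r.1.1.1 = (r'.1.1.2 - r'.1.1.1) / 2 /\
      r.2 - r.1.2 = (r'.2 - r'.1.2) / 2 /\
      `|flux_defect r'.1.1.1 r'.1.1.2 r'.1.2 r'.2| <=
      4 * `|flux_defect r.1.1.1 r.1.1.2 r.1.2 r.2|].
have /choice[step stepP] : forall r', exists r,
    r'.1.1.1 <= r'.1.1.2 -> r'.1.2 <= r'.2 -> quarter r' r.
  move=> r'.
  have [H1|] := pselect (r'.1.1.1 <= r'.1.1.2); last by exists r'.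
  have [H2|] := pselect (r'.1.2 <= r'.2); last by exists r'.
  by have [r rP] := flux_defect_quarter H1 H2; exists r => _ _; exact: rP.
pose r n := iter n step (a, b, c, d).
pose A n := (r n).1.1.1; pose B n := (r n).1.1.2.
pose C n := (r n).1.2; pose D n := (r n).2.
have ordr n : A n <= B n /\ C n <= D n.
  elim: n => [//|n [IH1 IH2]].
  by have [_ ? _ [_ ? _] _] := stepP (r n) IH1 IH2.
have rS n := stepP (r n) (ordr n).1 (ordr n).2.
have ndA n : A n <= A n.+1 by have [] := rS n.
have niB n : B n.+1 <= B n by have [] := rS n.
have ndC n : C n <= C n.+1 by have [_ _ _ []] := rS n.
have niD n : D n.+1 <= D n by have [_ _ _ []] := rS n.
have sizeAB n : B n - A n = (b - a) / 2 ^+ n.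
  elim: n => [|n IH]; first by rewrite expr0 divr1.
  have [_ _ _ _ [H _]] := rS n; rewrite -/(A n.+1) -/(B n.+1) in H.
  rewrite H -/(A n) -/(B n) IH exprSr invfM; ring.
have sizeCD n : D n - C n = (d - c) / 2 ^+ n.
  elim: n => [|n IH]; first by rewrite expr0 divr1.
  have [_ _ _ _ [_ [H _]]] := rS n; rewrite -/(C n.+1) -/(D n.+1) in H.
  rewrite H -/(C n) -/(D n) IH exprSr invfM; ring.
have defn n : `|flux_defect a b c d| <= 4 ^+ n * `|flux_defect (A n) (B n) (C n) (D n)|.
  elim: n => [|n IH]; first by rewrite expr0 mul1r.
  apply: le_trans IH _; rewrite exprSr -mulrA ler_wpM2l ?exprn_ge0//.
  by have [_ _ _ _ [_ [_]]] := rS n.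
(* the left and right ends of the nested intervals enclose a common point *)
have mono (u v : nat -> R) : (forall n, u n <= u n.+1) -> (forall n, v n.+1 <= v n) ->
    (forall n, u n <= v n) -> exists p, forall n, u n <= p <= v n.
  move=> ndu niv uv.
  have nd m n : (m <= n)%N -> u m <= u n.
    by move=> mn; apply: (nondecreasing_seqP _).1 mn.
  have ni m n : (m <= n)%N -> v n <= v m.
    by move=> mn; apply: (nonincreasing_seqP _).1 mn.
  have umv m n : u m <= v n.
    have [mn|/ltnW nm] := leqP m n; first exact: le_trans (nd _ _ mn) (uv n).
    exact: le_trans (uv m) (ni _ _ nm).
  exists (sup (range u)) => n; apply/andP; split.
    apply: ub_le_sup; last by exists n.
    by exists (v 0%N) => _ [k _ <-].
  by apply: ge_sup; [exists (u 0%N); exists 0%N|move=> _ [k _ <-]].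
have [p pP] := mono A B ndA niB (fun n => (ordr n).1).
have [q qP] := mono C D ndC niD (fun n => (ordr n).2).
have := loc p q (pP 0%N) (qP 0%N) => /flux_defect_small {}loc.
pose L := (b - a) + (d - c).
have L0 : 0 <= L by rewrite /L; lra.
apply/normr0_eq0/eqP; rewrite eq_le normr_ge0 andbT.
apply/ler_addgt0Pl => e e0; rewrite addr0.
have e'0 : 0 < e / (L ^+ 2 + 1) by rewrite divr_gt0// ltr_wpDl// sqr_ge0.
have [s s0 {}loc] := loc _ e'0.
have [n nP] : exists n, L / 2 ^+ n < s.
  have [n Ln] : exists n : nat, L / s < n%:R.
    by exists (Num.bound (L / s)); rewrite archi_boundP// divr_ge0// ltW.
  exists n; rewrite ltr_pdivrMr ?exprn_gt0//.
  move: Ln; rewrite ltr_pdivrMr// mulrC => /lt_le_trans; apply.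
  by rewrite ler_wpM2l ?(ltW s0)// -natrX ler_nat ltnW// ltn_expl.
have := loc (A n) (B n) (C n) (D n) (pP n) (qP n).
rewrite sizeAB sizeCD -mulrDl -/L => /(_ nP) H.
apply: le_trans (defn n) _.
apply: (@le_trans _ _ (4 ^+ n * (e / (L ^+ 2 + 1) * (L / 2 ^+ n) ^+ 2))).
  by rewrite ler_wpM2l// exprn_ge0.
rewrite expr_div_n -exprM mulnC exprM.
have -> : (2 ^+ 2 : R) = 4 by ring.
have -> : 4 ^+ n * (e / (L ^+ 2 + 1) * (L ^+ 2 / 4 ^+ n)) = e / (L ^+ 2 + 1) * L ^+ 2.
  by field; rewrite expf_neq0//= gt_eqF// ltr_wpDl// sqr_ge0.
rewrite mulrAC ler_pdivrMr ?ltr_wpDl ?sqr_ge0// ler_wpM2l ?(ltW e0)//.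
by rewrite lerDl.
Qed.

End divergence.

(** * The divergence theorem on the plane, with one exceptional point *)

Section divergence_plane.
Variable R : realType.
Notation mu := (@lebesgue_measure R).
Notation lam := (lebesgue_plane R).
Notation plane := (measurableTypeR R * measurableTypeR R)%type.
Variables (P Q : R -> R -> R) (G : plane -> R).
Hypothesis P_cont : forall x, continuous (P x).
Hypothesis Q_cont : forall y, continuous (Q ^~ y).
Hypothesis G_int : lam.-integrable setT (EFin \o G).

Lemma flux_defect_le a b c d (K : R) : a <= b -> c <= d -> 0 <= K ->
  (forall x y, a <= x <= b -> c <= y <= d ->
    [/\ `|P x y| <= K, `|Q x y| <= K & `|G (x, y)| <= K]) ->
  `|flux_defect P Q G a b c d| <=
    K * (2 * (b - a) + 2 * (d - c) + (b - a) * (d - c)).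
Proof.
move=> ab cd K0 bnd.
have aab : a <= a <= b by rewrite lexx.
have bab : a <= b <= b by rewrite lexx ab.
have ccd : c <= c <= d by rewrite lexx.
have dcd : c <= d <= d by rewrite lexx cd.
have E1 : `|\int[mu]_(y in `]c, d]) (P b y - P a y)| <= 2 * K * (d - c).
  have := @Rintegral_near_cst _ _ R mu `]c, d]%classic
    (fun y => P b y - P a y) 0 (2 * K).
  rewrite fine_lebesgue_itv// mul0r subr0; apply.
  - exact: measurable_itv.
  - exact: lebesgue_itv_lty.
  - apply: integrable_subR; first exact: measurable_itv.
      exact: continuous_integrable_itv.
    exact: continuous_integrable_itv.
  - move=> y /=; rewrite in_itv/= => /andP[/ltW cy yd].
    have cyd : c <= y <= d by rewrite cy.
    rewrite subr0 (le_trans (ler_normB _ _))//.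
    by have [? _ _] := bnd _ _ aab cyd; have [? _ _] := bnd _ _ bab cyd; lra.
have E2 : `|\int[mu]_(x in `]a, b]) (Q x d - Q x c)| <= 2 * K * (b - a).
  have := @Rintegral_near_cst _ _ R mu `]a, b]%classic
    (fun x => Q x d - Q x c) 0 (2 * K).
  rewrite fine_lebesgue_itv// mul0r subr0; apply.
  - exact: measurable_itv.
  - exact: lebesgue_itv_lty.
  - apply: integrable_subR; first exact: measurable_itv.
      by have /= := @continuous_integrable_itv R (Q ^~ d) a b (@Q_cont d).
    by have /= := @continuous_integrable_itv R (Q ^~ c) a b (@Q_cont c).
  - move=> x /=; rewrite in_itv/= => /andP[/ltW ax xb].
    have axb : a <= x <= b by rewrite ax.
    rewrite subr0 (le_trans (ler_normB _ _))//.
    by have [_ ? _] := bnd _ _ axb ccd; have [_ ? _] := bnd _ _ axb dcd; lra.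
have E3 : `|\int[lam]_(z in rect a b c d) G z| <= K * ((b - a) * (d - c)).
  have := @Rintegral_near_cst _ _ R lam (rect a b c d) G 0 K.
  rewrite [fine _](congr1 fine (lebesgue_plane_rect ab cd)) mul0r subr0; apply.
  - exact: measurable_rect.
  - by apply: (@le_lt_trans _ _ ((b - a) * (d - c))%:E); rewrite ?ltry// -lebesgue_plane_rect.
  - by apply: integrableS G_int => //; exact: measurable_rect.
  - move=> [x y] []/=; rewrite !in_itv/= => /andP[/ltW ax xb] /andP[/ltW cy yd].
    rewrite subr0; have [||_ _ //] := bnd x y; exact/andP.
rewrite /flux_defect; apply: le_trans (ler_normB _ _) _.
apply: le_trans (lerD (ler_normD _ _) E3) _.
by apply: le_trans (lerD (lerD E1 E2) (lexx _)) _; lra.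
Qed.

Variables p0 q0 : R.
Hypothesis divPQ : forall p q, (p != p0) || (q != q0) -> has_divergence P Q G p q.
Hypothesis bounded_near : exists K r : R, [/\ 0 <= K, 0 < r &
  forall x y, `|x - p0| < r -> `|y - q0| < r ->
    [/\ `|P x y| <= K, `|Q x y| <= K & `|G (x, y)| <= K]].

(** A small square around the exceptional point is cut out. The defect vanishes
    on the rest, and that of the square is bounded by its perimeter and area, as
    P, Q and G are bounded near the point. *)
Lemma divergence_rect_punctured a b c d : a < p0 < b -> c < q0 < d ->
  flux_defect P Q G a b c d = 0.
Proof.
move=> /andP[ap pb] /andP[cq qd].
have [K [r [K0 r0 bnd]]] := bounded_near.
apply/normr0_eq0/eqP; rewrite eq_le normr_ge0 andbT.
apply/ler_addgt0Pl => e e0; rewrite addr0.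
(* half-side of the square: it fits in the rectangle and in the neighbourhood
   where K is a bound, and makes the defect at most 12 K h <= e *)
pose h : R := Num.min (Num.min 1 (r / 2)) (Num.min (Num.min (p0 - a) (b - p0))
  (Num.min (Num.min (q0 - c) (d - q0)) (e / (12 * (K + 1))))).
have h0 : 0 < h.
  by rewrite /h !lt_min !subr_gt0 ap pb cq qd ltr01 divr_gt0//= divr_gt0// mulr_gt0// ltr_wpDl.
have : h <= h by [].
rewrite {2}/h !le_min => /andP[/andP[h1 hr] /andP[/andP[ha hb] /andP[/andP[hc hd] he]]].
have [a1 [b1 [c1 d1]]] : a <= p0 - h /\ p0 + h <= b /\ c <= q0 - h /\ q0 + h <= d.
  by split; [|split; [|split]]; lra.
have ph : p0 - h <= p0 + h by lra.
have qh : q0 - h <= q0 + h by lra.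
have pneq x : x <= p0 - h \/ p0 + h <= x -> x != p0.
  by move=> H; apply/eqP => E; rewrite E in H; case: H; lra.
have qneq x : x <= q0 - h \/ q0 + h <= x -> x != q0.
  by move=> H; apply/eqP => E; rewrite E in H; case: H; lra.
rewrite (flux_defect_splitx P_cont Q_cont G_int c d a1 (le_trans ph b1)).
rewrite (flux_defect_splitx P_cont Q_cont G_int c d ph b1).
rewrite [flux_defect _ _ _ _ _ c d](divergence_rect P_cont Q_cont G_int a1); last 2 first.
- lra.
- by move=> p q /andP[_ pp] _; apply: divPQ; rewrite pneq//; left.
rewrite [flux_defect _ _ _ _ b _ _](divergence_rect P_cont Q_cont G_int b1); last 2 first.
- lra.
- by move=> p q /andP[pp _] _; apply: divPQ; rewrite pneq//; right.
rewrite (flux_defect_splity P_cont Q_cont G_int _ _ c1 (le_trans qh d1)).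
rewrite (flux_defect_splity P_cont Q_cont G_int _ _ qh d1).
rewrite (divergence_rect P_cont Q_cont G_int ph c1); last first.
  by move=> p q _ /andP[_ pp]; apply: divPQ; rewrite (qneq q) ?orbT//; left.
rewrite (divergence_rect P_cont Q_cont G_int ph d1); last first.
  by move=> p q _ /andP[pp _]; apply: divPQ; rewrite (qneq q) ?orbT//; right.
rewrite !add0r !addr0; apply: le_trans.
  apply: (@flux_defect_le _ _ _ _ K ph qh K0) => x y /andP[x1 x2] /andP[y1 y2].
  by apply: bnd; rewrite ltr_norml; apply/andP; split; lra.
have -> : p0 + h - (p0 - h) = 2 * h by ring.
have -> : q0 + h - (q0 - h) = 2 * h by ring.
apply: (@le_trans _ _ (K * (12 * h))).
  rewrite ler_wpM2l//.
  have : h * h <= 1 * h by rewrite ler_wpM2r// ltW.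
  lra.
move: he; rewrite ler_pdivlMr; last by rewrite mulr_gt0// ltr_wpDl.
move=> he; apply: le_trans he; rewrite mulrCA [h * _]mulrCA ler_wpM2l//.
by rewrite mulrC ler_wpM2l ?lerDl ?(ltW h0).
Qed.

(** Otherwise the integral would be at least e times the infinite measure of D. *)
Lemma small_slice (m : R -> \bar R) (D : set R) (e : R) :
  measurable_fun [set: measurableTypeR R] m -> (forall x, 0 <= m x)%E ->
  (\int[mu]_x m x < +oo)%E -> measurable (D : set (measurableTypeR R)) ->
  mu D = +oo%E -> 0 < e -> exists2 x, D x & (m x < e%:E)%E.
Proof.
move=> mm m0 im mD Doo e0; apply: contrapT => H.
have mge x : D x -> (e%:E <= m x)%E.
  by move=> Dx; rewrite leNgt; apply/negP => mx; apply: H; exists x.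
have : (\int[mu]_(x in D) (cst e%:E x) <= \int[mu]_x m x)%E.
  apply: (@le_trans _ _ (\int[mu]_(x in D) m x)%E).
    apply: ge0_le_integral => //.
    - by move=> x _; rewrite lee_fin ltW.
    - exact: measurable_funS mm.
  by apply: ge0_subset_integral => //.
have -> : (\int[mu]_(x in D) (cst e%:E x) = +oo)%E.
  rewrite integral_cst//; transitivity (e%:E * +oo)%E; last first.
    by rewrite gt0_muley.
  by congr (_ * _)%E; exact: Doo.
by rewrite leye_eq => /eqP E; rewrite E in im.
Qed.

Hypothesis P_int : lam.-integrable setT (fun z => (P z.1 z.2)%:E).
Hypothesis Q_int : lam.-integrable setT (fun z => (Q z.1 z.2)%:E).

(** Rectangles containing the square of half-side N, on whose sides P and Q
    integrate to little: by Fubini almost every line carries a finite integral,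
    and [small_slice] finds lines as far as one likes with a small one. *)
Lemma slices_small (e : R) : 0 < e -> forall N : R, exists a b c d : R,
  [/\ a <= - N, N <= b, c <= - N, N <= d &
   [/\ (\int[mu]_y `|(P a y)%:E| < e%:E)%E, (\int[mu]_y `|(P b y)%:E| < e%:E)%E,
     (\int[mu]_x `|(Q x c)%:E| < e%:E)%E & (\int[mu]_x `|(Q x d)%:E| < e%:E)%E]].
Proof.
move=> e0 N.
have mPabs : measurable_fun setT (fun z : plane => `|(P z.1 z.2)%:E|%E).
  by apply: measurableT_comp => //; exact: measurable_int P_int.
have mQabs : measurable_fun setT (fun z : plane => `|(Q z.1 z.2)%:E|%E).
  by apply: measurableT_comp => //; exact: measurable_int Q_int.
have /integrableP[_ iP] := P_int; have /integrableP[_ iQ] := Q_int.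
pose mP x := (\int[mu]_y `|(P x y)%:E|)%E.
pose mQ y := (\int[mu]_x `|(Q x y)%:E|)%E.
have mmP : measurable_fun setT mP.
  by apply: (measurable_fun_fubini_tonelli_F (fun z : plane => `|(P z.1 z.2)%:E|%E)).
have mmQ : measurable_fun setT mQ.
  by apply: (measurable_fun_fubini_tonelli_G (fun z : plane => `|(Q z.1 z.2)%:E|%E)).
have iP' : (\int[mu]_x mP x < +oo)%E.
  apply: le_lt_trans iP.
  by rewrite -(fubini_tonelli1 (fun z : plane => `|(P z.1 z.2)%:E|%E)).
have iQ' : (\int[mu]_y mQ y < +oo)%E.
  apply: le_lt_trans iQ.
  by rewrite -(fubini_tonelli2 (fun z : plane => `|(Q z.1 z.2)%:E|%E)).
have mP0 x : (0 <= mP x)%E by exact: integral_ge0.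
have mQ0 x : (0 <= mQ x)%E by exact: integral_ge0.
have muy : mu `[N, +oo[%classic = +oo%E by rewrite lebesgue_measure_itv/= ltry.
have muNy : mu `]-oo, (- N)]%classic = +oo%E by rewrite lebesgue_measure_itv/= ltNyr.
have [a aN aP] := small_slice mmP mP0 iP' (measurable_itv _) muNy e0.
have [b bN bP] := small_slice mmP mP0 iP' (measurable_itv _) muy e0.
have [c cN cP] := small_slice mmQ mQ0 iQ' (measurable_itv _) muNy e0.
have [d dN dP] := small_slice mmQ mQ0 iQ' (measurable_itv _) muy e0.
exists a, b, c, d; move: aN bN cN dN; rewrite /= !in_itv/= !andbT.
by split.
Qed.

Lemma le_Rintegral_slice (f : R -> R) (a b e : R) : continuous f ->
  (\int[mu]_y `|(f y)%:E| < e%:E)%E -> `|\int[mu]_(y in `]a, b]) f y| <= e.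
Proof.
move=> cf fe; rewrite -lee_fin EFin_normr_Rintegral; last 2 first.
- exact: measurable_itv.
- exact: continuous_integrable_itv.
have mf : measurable_fun [set: measurableTypeR R] (EFin \o f).
  by apply/measurable_EFinP; exact: continuous_measurable_fun.
apply: le_trans (le_abse_integral _ _ _) _ => //.
  exact: measurable_funS mf.
apply: le_trans (ltW fe); apply: ge0_subset_integral => //.
exact: measurableT_comp.
Qed.

(** Integrability of P and Q takes the place of decay at infinity: the boundary
    terms vanish in the limit along the rectangles of [slices_small]. *)
Theorem divergence_plane : \int[lam]_z G z = 0.
Proof.
pose N n : R := n%:R + 1 + `|p0| + `|q0|.
pose e n : R := n.+1%:R^-1.
have e0 n : 0 < e n by rewrite /e invr_gt0.
have ch : forall n, exists s : R * R * R * R,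
   [/\ s.1.1.1 <= - N n, N n <= s.1.1.2, s.1.2 <= - N n, N n <= s.2 &
   [/\ (\int[mu]_y `|(P s.1.1.1 y)%:E| < (e n)%:E)%E,
     (\int[mu]_y `|(P s.1.1.2 y)%:E| < (e n)%:E)%E,
     (\int[mu]_x `|(Q x s.1.2)%:E| < (e n)%:E)%E &
     (\int[mu]_x `|(Q x s.2)%:E| < (e n)%:E)%E]].
  move=> n; have [a [b [c [d H]]]] := slices_small (e0 n) (N n).
  by exists (a, b, c, d).
have /choice[s sP] := ch.
pose D n := rect (s n).1.1.1 (s n).1.1.2 (s n).1.2 (s n).2.
have mD n : measurable (D n) by exact: measurable_rect.
have small n : `|\int[lam]_(z in D n) G z| <= 4 * e n.
  have [sa sb sc sd [Pa Pb Qc Qd]] := sP n.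
  have Np : `|p0| < N n by rewrite /N; have := ler0n R n; have := normr_ge0 q0; lra.
  have Nq : `|q0| < N n by rewrite /N; have := ler0n R n; have := normr_ge0 p0; lra.
  move: Np Nq; rewrite !ltr_norml => /andP[Np1 Np2] /andP[Nq1 Nq2].
  have := @divergence_rect_punctured (s n).1.1.1 (s n).1.1.2 (s n).1.2 (s n).2.
  rewrite (le_lt_trans sa Np1) (lt_le_trans Np2 sb).
  rewrite (le_lt_trans sc Nq1) (lt_le_trans Nq2 sd) => /(_ isT isT).
  rewrite /flux_defect => /eqP; rewrite subr_eq0 => /eqP <-.
  have iP x a b : mu.-integrable `]a, b] (EFin \o P x).
    exact: continuous_integrable_itv.
  have iQ y a b : mu.-integrable `]a, b] (EFin \o (Q ^~ y)).
    exact: continuous_integrable_itv.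
  rewrite !RintegralB//; try exact: measurable_itv.
  apply: le_trans (ler_normD _ _) _.
  apply: le_trans (lerD (ler_normB _ _) (ler_normB _ _)) _.
  have H1 := le_Rintegral_slice (s n).1.2 (s n).2 (@P_cont _) Pa.
  have H2 := le_Rintegral_slice (s n).1.2 (s n).2 (@P_cont _) Pb.
  have H3 := le_Rintegral_slice (s n).1.1.1 (s n).1.1.2 (@Q_cont _) Qc.
  have H4 := le_Rintegral_slice (s n).1.1.1 (s n).1.1.2 (@Q_cont _) Qd.
  by apply: le_trans (lerD (lerD H2 H1) (lerD H4 H3)) _; lra.
have mG : measurable_fun setT (EFin \o G) by exact: measurable_int G_int.
pose GD n := (EFin \o G) \_ (D n).
have mGD n : measurable_fun setT (GD n).
  by apply/(measurable_restrictT _ (mD n)); exact: measurable_funS mG.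
have inD z : exists n0, forall n, (n0 <= n)%N -> D n z.
  pose M := `|z.1| + `|z.2|.
  exists (Num.bound M) => n nM.
  have Mn : M < n%:R.
    by apply: lt_le_trans (archi_boundP _) _; rewrite ?addr_ge0// ler_nat.
  have [sa sb sc sd _] := sP n.
  have MN : M < N n.
    by rewrite /N; have := normr_ge0 q0; have := normr_ge0 p0; lra.
  have : `|z.1| < N n by apply: le_lt_trans MN; rewrite lerDl.
  have : `|z.2| < N n by apply: le_lt_trans MN; rewrite lerDr.
  rewrite !ltr_norml => /andP[y1 y2] /andP[x1 x2].
  split => /=; rewrite in_itv/=; apply/andP; split; lra.
have GD_cvg : {ae lam, forall z, setT z -> GD ^~ z @ \oo --> (EFin \o G) z}.
  apply: aeW => z _; have [n0 n0P] := inD z.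
  apply: cvg_near_cst; exists n0 => // n /= /n0P nD.
  by rewrite /GD patchE mem_set.
have GD_le : {ae lam, forall z n, setT z -> (`|GD n z| <= (abse \o (EFin \o G)) z)%E}.
  apply: aeW => z n _; rewrite /GD patchE.
  by case: ifP => _ /=; rewrite lee_fin ?normr0.
have [_ _ cvgI] := dominated_convergence measurableT mGD mG GD_cvg
  (integrable_abse G_int) GD_le.
have GDE n : (\int[lam]_z GD n z)%E = (\int[lam]_(z in D n) G z)%:E.
  rewrite /GD -integral_mkcond /Rintegral fineK//.
  apply: integrable_fin_num; first exact: mD.
  by apply: integrableS G_int => //; exact: mD.
have cvg0 : (\int[lam]_z GD n z)%E @[n --> \oo] --> 0%E.
  under eq_fun do rewrite GDE.
  apply: cvg_EFin; first exact: nearW.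
  apply/norm_cvg0P.
  have e4 : 4 * e n @[n --> \oo] --> 4 * (0 : R).
    by apply: cvgM; [exact: cvg_cst|exact: cvg_harmonic].
  rewrite mulr0 in e4.
  apply: (squeeze_cvgr _ (cvg_cst 0) e4).
  by apply: nearW => n /=; rewrite normr_ge0/=; exact: small.
have -> : \int[lam]_z G z = fine 0%E by congr fine; apply: cvg_unique cvgI cvg0.
by [].
Qed.

End divergence_plane.

(** * Modulus of complex numbers *)

Section complex_norm.
Variable R : realType.
Local Notation C := R[i].
Implicit Types x y z : C.

Lemma normc_addle x y : normc (x + y) <= normc x + normc y.
Proof. exact: (@le_normcD R x y). Qed.

Lemma normc_opp x : normc (- x) = normc x.
Proof. exact: (@normcN R x). Qed.

Lemma normc_suble x y : normc (x - y) <= normc x + normc y.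
Proof. by rewrite -(normc_opp y); exact: normc_addle. Qed.

Lemma normc_subC x y : normc (x - y) = normc (y - x).
Proof. by rewrite -normc_opp opprB. Qed.

Lemma normc_ge0 x : 0 <= normc x.
Proof. by case: x => a b; exact: sqrtr_ge0. Qed.

Lemma sqr_normc x : normc x ^+ 2 = complex.Re x ^+ 2 + complex.Im x ^+ 2.
Proof. by case: x => a b /=; rewrite sqr_sqrtr// addr_ge0// sqr_ge0. Qed.

Lemma normc_conj x : normc (conjc x) = normc x.
Proof. by case: x => a b /=; rewrite sqrrN. Qed.

Lemma normc_sqr x : normc (x ^+ 2) = normc x ^+ 2.
Proof. by rewrite !expr2 normcM. Qed.

Lemma mulc_conj x : x * conjc x = (normc x ^+ 2)%:C.
Proof.
rewrite sqr_normc; case: x => a b /=; apply/eqP; rewrite eq_complex /=.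
by apply/andP; split; apply/eqP; ring.
Qed.

Lemma Re_le_normc x : `|complex.Re x| <= normc x.
Proof.
rewrite -(ler_pXn2r (n := 2))// ?nnegrE// ?normc_ge0//.
by rewrite sqr_normc real_normK ?num_real// lerDl sqr_ge0.
Qed.

Lemma Im_le_normc x : `|complex.Im x| <= normc x.
Proof.
rewrite -(ler_pXn2r (n := 2))// ?nnegrE// ?normc_ge0//.
by rewrite sqr_normc real_normK ?num_real// lerDr sqr_ge0.
Qed.

Lemma normc_le_ReIm x : normc x <= `|complex.Re x| + `|complex.Im x|.
Proof.
rewrite -(ler_pXn2r (n := 2))// ?nnegrE ?addr_ge0// ?normc_ge0//.
rewrite sqr_normc -[X in X + _]real_normK ?num_real//.
rewrite -[X in _ + X]real_normK ?num_real//.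
by rewrite sqrrD -addrA [_ *+ 2 + _]addrC addrA lerDl mulrn_wge0// mulr_ge0.
Qed.

Lemma normc_real (a : R) : normc a%:C = `|a|.
Proof. by rewrite /= expr0n/= addr0 sqrtr_sqr. Qed.

Lemma normc_gt0 x : (0 < normc x) = (x != 0).
Proof.
rewrite lt_def normc_ge0 andbT; apply/idP/idP; apply: contra => /eqP.
  by move=> ->; rewrite normc0.
by move/eq0_normc => ->.
Qed.

Lemma Re_add x y : complex.Re (x + y) = complex.Re x + complex.Re y.
Proof. by case: x y => [a b] [c d]. Qed.

Lemma Im_add x y : complex.Im (x + y) = complex.Im x + complex.Im y.
Proof. by case: x y => [a b] [c d]. Qed.

Lemma Re_opp x : complex.Re (- x) = - complex.Re x.
Proof. by case: x. Qed.

Lemma Im_opp x : complex.Im (- x) = - complex.Im x.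
Proof. by case: x. Qed.

Lemma Re_mul x y : complex.Re (x * y) =
  complex.Re x * complex.Re y - complex.Im x * complex.Im y.
Proof. by case: x y => [a b] [c d]. Qed.

Lemma Im_mul x y : complex.Im (x * y) =
  complex.Re x * complex.Im y + complex.Im x * complex.Re y.
Proof. by case: x y => [a b] [c d]. Qed.

Lemma Re_conj x : complex.Re (conjc x) = complex.Re x. Proof. by case: x. Qed.
Lemma Im_conj x : complex.Im (conjc x) = - complex.Im x. Proof. by case: x. Qed.

Definition ReImE := (Re_add, Im_add, Re_opp, Im_opp, Re_mul, Im_mul, Re_conj, Im_conj).

Lemma eqc_ReIm x y :
  complex.Re x = complex.Re y -> complex.Im x = complex.Im y -> x = y.
Proof. by case: x y => [a b] [c d] /= -> ->. Qed.

End complex_norm.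

(** * The complex exponential *)

Section complex_exponential.
Variable R : realType.
Local Notation C := R[i].

Definition cexp (z : C) : C :=
  (expR (complex.Re z) * cos (complex.Im z)) +i*
  (expR (complex.Re z) * sin (complex.Im z)).

Lemma cexpD (x y : C) : cexp (x + y) = cexp x * cexp y.
Proof.
apply: eqc_ReIm; rewrite /cexp !ReImE/= expRD ?cosD ?sinD; ring.
Qed.

Lemma cexp0 : cexp 0 = 1.
Proof. by apply: eqc_ReIm; rewrite /cexp/= expR0 ?cos0 ?sin0 ?mulr1 ?mulr0. Qed.

Lemma normc_cexp (z : C) : normc (cexp z) = expR (complex.Re z).
Proof.
by rewrite /cexp/= !exprMn -mulrDr cos2Dsin2 mulr1 sqrtr_sqr ger0_norm// expR_ge0.
Qed.

Lemma conj_cexp (z : C) : conjc (cexp z) = cexp (conjc z).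
Proof. by apply: eqc_ReIm; rewrite /cexp !ReImE/= ?cosN ?sinN ?mulrN. Qed.

Lemma cexp_real (x : R) : cexp x%:C = (expR x)%:C.
Proof. by apply: eqc_ReIm; rewrite /cexp/= ?cos0 ?sin0 ?mulr1 ?mulr0. Qed.

Lemma mean_value_bound (f df : R -> R) (x K : R) :
  (forall y : R, is_derive y (1 : R) f (df y)) -> (forall y, `|y| <= `|x| -> `|df y| <= K) ->
  `|f x - f 0| <= K * `|x|.
Proof.
move=> fd dfK.
have cf : continuous f.
  by move=> y; apply/differentiable_continuous/derivable1_diffP; have [] := fd y.
have [x0|x0] := leP 0 x.
  have [|c] := @MVT_segment R f df 0 x x0 (fun y _ => fd y).
    exact: continuous_subspaceT.
  rewrite in_itv/= => /andP[c0 cx] ->; rewrite subr0 normrM ler_wpM2r//.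
  by apply: dfK; rewrite !ger0_norm.
have [|c] := @MVT_segment R f df x 0 (ltW x0) (fun y _ => fd y).
  exact: continuous_subspaceT.
rewrite in_itv/= => /andP[xc c0].
rewrite distrC => ->; rewrite sub0r normrM normrN ler_wpM2r//.
by apply: dfK; rewrite !ler0_norm ?lerN2// ltW.
Qed.

Lemma ler_norm_sin (x : R) : `|sin x| <= `|x|.
Proof.
have := @mean_value_bound sin cos x 1 (@is_derive_sin R) (fun y _ => cos_max y).
by rewrite sin0 subr0 mul1r.
Qed.

Lemma ler_norm_cosB1 (x : R) : `|cos x - 1| <= `|x| ^+ 2.
Proof.
have := @mean_value_bound cos (fun y => - sin y) x `|x| (@is_derive_cos R).
rewrite cos0 expr2; apply => y yx; rewrite normrN.
exact: le_trans (ler_norm_sin y) yx.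
Qed.

Lemma ler_norm_cosB1_lin (x : R) : `|cos x - 1| <= `|x|.
Proof.
have := @mean_value_bound cos (fun y => - sin y) x 1 (@is_derive_cos R).
rewrite cos0 mul1r; apply => y yx; rewrite normrN; exact: sin_max.
Qed.

Lemma ler_norm_sinB (x : R) : `|sin x - x| <= `|x| ^+ 2.
Proof.
have := @mean_value_bound (fun y => sin y - y) (fun y => cos y - 1) x `|x|.
rewrite sin0 !subr0 expr2; apply => y yx.
exact: le_trans (ler_norm_cosB1_lin y) yx.
Qed.

Lemma ler_norm_expRB1 (x : R) : `|expR x - 1| <= `|x| * expR `|x|.
Proof.
have [x0|x0] := leP 0 x.
  rewrite !ger0_norm ?subr_ge0 -?expR0 ?ler_expR//; rewrite expR0.
  have : 1 - x <= expR (- x) by exact: expR_ge1Dx.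
  have ex : expR (- x) * expR x = 1 by rewrite -expRD addNr expR0.
  move=> /(ler_wpM2r (expR_ge0 x)); rewrite ex; lra.
have ex1 : expR x - 1 < 0 by rewrite subr_lt0 -expR0 ltr_expR.
rewrite (ltr0_norm ex1) (ltr0_norm x0).
have H1 := expR_ge1Dx x; have : 1 <= expR (- x) by rewrite -expR0 ler_expR; lra.
have Nx : 0 <= - x by lra.
by move=> /(ler_wpM2l Nx); lra.
Qed.

Lemma ler_norm_expRB1D (x : R) : `|expR x - 1 - x| <= `|x| ^+ 2 * expR `|x|.
Proof.
have H : expR x - 1 <= x * expR x.
  have : 1 - x <= expR (- x) by exact: expR_ge1Dx.
  have ex : expR (- x) * expR x = 1 by rewrite -expRD addNr expR0.
  move=> /(ler_wpM2r (expR_ge0 x)); rewrite ex; lra.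
rewrite ger0_norm; last by have := expR_ge1Dx x; lra.
apply: (@le_trans _ _ (x * (expR x - 1))); first lra.
apply: le_trans (ler_norm _) _; rewrite normrM expr2 -mulrA ler_wpM2l//.
exact: ler_norm_expRB1.
Qed.

Lemma normc_cexpB1 (z : C) : normc (cexp z - 1) <= 3 * normc z * expR (normc z).
Proof.
apply: le_trans (normc_le_ReIm _) _.
rewrite /cexp !ReImE/= subr0.
have xt := Re_le_normc z; have yt := Im_le_normc z.
set t := normc z in xt yt *; set x := complex.Re z in xt *.
set y := complex.Im z in yt *.
have t0 : 0 <= t by exact: normc_ge0.
have ex : expR `|x| <= expR t by rewrite ler_expR.
have ex' : expR x <= expR t by rewrite ler_expR (le_trans (ler_norm _)).
have -> : expR x * cos y - 1 = (expR x - 1) + expR x * (cos y - 1) by ring.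
have H1 : `|expR x - 1| <= t * expR t.
  by apply: le_trans (ler_norm_expRB1 x) _; rewrite ler_pM// expR_ge0.
have H2 : `|expR x * (cos y - 1)| <= expR t * t.
  rewrite normrM ler_pM// ?(ger0_norm (expR_ge0 _))//.
  exact: le_trans (ler_norm_cosB1_lin y) yt.
have H3 : `|expR x * sin y| <= expR t * t.
  rewrite normrM ler_pM// ?(ger0_norm (expR_ge0 _))//.
  exact: le_trans (ler_norm_sin y) yt.
apply: le_trans (lerD (le_trans (ler_normD _ _) (lerD H1 H2)) H3) _.
lra.
Qed.

Lemma normc_cexpB1B (z : C) :
  normc (cexp z - 1 - z) <= 4 * normc z ^+ 2 * expR (normc z).
Proof.
apply: le_trans (normc_le_ReIm _) _.
rewrite /cexp !ReImE/= subr0.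
have xt := Re_le_normc z; have yt := Im_le_normc z.
set t := normc z in xt yt *; set x := complex.Re z in xt *.
set y := complex.Im z in yt *.
have t0 : 0 <= t by exact: normc_ge0.
have ex : expR `|x| <= expR t by rewrite ler_expR.
have e1 : 1 + t <= expR t by exact: expR_ge1Dx.
have sq u : `|u| <= t -> `|u| ^+ 2 <= t ^+ 2 by move=> ut; rewrite lerXn2r ?nnegrE.
have -> : expR x * cos y - 1 - x = (expR x - 1 - x) * cos y + (1 + x) * (cos y - 1).
  by ring.
have -> : expR x * sin y - y = (expR x - 1) * sin y + (sin y - y) by ring.
have H1 : `|(expR x - 1 - x) * cos y| <= t ^+ 2 * expR t.
  rewrite normrM -[leRHS]mulr1 ler_pM// ?cos_max//.
  by apply: le_trans (ler_norm_expRB1D x) _; rewrite ler_pM ?expR_ge0 ?sqr_ge0// sq.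
have H2 : `|(1 + x) * (cos y - 1)| <= expR t * t ^+ 2.
  rewrite normrM ler_pM//; last by apply: le_trans (ler_norm_cosB1 y) _; exact: sq.
  by apply: le_trans e1; apply: le_trans (ler_normD _ _) _; rewrite normr1 lerD2l.
have H3 : `|(expR x - 1) * sin y| <= (t * expR t) * t.
  rewrite normrM ler_pM//; last exact: le_trans (ler_norm_sin y) yt.
  by apply: le_trans (ler_norm_expRB1 x) _; rewrite ler_pM// expR_ge0.
have H4 : `|sin y - y| <= t ^+ 2 * expR t.
  apply: le_trans (ler_norm_sinB y) _; rewrite -[leLHS]mulr1 ler_pM// ?sqr_ge0 ?sq//.
  lra.
apply: le_trans (lerD (ler_normD _ _) (ler_normD _ _)) _.
apply: le_trans (lerD (lerD H1 H2) (lerD H3 H4)) _.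
lra.
Qed.

End complex_exponential.

(** * First-order expansions in z and its conjugate *)

Section wirtinger.
Variable R : realType.
Local Notation C := R[i].
Implicit Types (F G : C -> C) (p z w A B : C).

(** Real radii keep the estimates in the ordered field R, whereas the balls of
    R[i], as a normed space over itself, have their radii in R[i]. *)
Definition nearc p (S : C -> Prop) : Prop :=
  exists2 r : R, 0 < r & forall z, normc (z - p) < r -> S z.

Lemma nearc_and p (S S' : C -> Prop) :
  nearc p S -> nearc p S' -> nearc p (fun z => S z /\ S' z).
Proof.
move=> [r r0 rS] [s s0 sS]; exists (Num.min r s); first by rewrite lt_min r0.
by move=> z; rewrite lt_min => /andP[zr zs]; split; [exact: rS|exact: sS].
Qed.

Lemma nearc_sub p (S S' : C -> Prop) :
  (forall z, S z -> S' z) -> nearc p S -> nearc p S'.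
Proof. by move=> SS [r r0 rS]; exists r => // z /rS /SS. Qed.

Lemma nearc_ball p (r : R) : 0 < r -> nearc p (fun z => normc (z - p) < r).
Proof. by exists r. Qed.

Definition continuous_atc F p : Prop :=
  forall e : R, 0 < e -> nearc p (fun z => normc (F z - F p) <= e).

(** A and B are the derivatives of F at p with respect to z and to its conjugate;
    F is complex differentiable at p when B = 0. *)
Definition has_wirtinger F p A B : Prop :=
  forall e : R, 0 < e -> nearc p (fun z =>
    normc (F z - F p - (A * (z - p) + B * conjc (z - p))) <= e * normc (z - p)).

Lemma has_wirtinger_lip F p A B : has_wirtinger F p A B ->
  nearc p (fun z => normc (F z - F p) <= (normc A + normc B + 1) * normc (z - p)).
Proof.
move=> /(_ 1 ltr01); apply: nearc_sub => z; rewrite mul1r => H.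
rewrite -(subrK (A * (z - p) + B * conjc (z - p)) (F z - F p)).
apply: le_trans (normc_addle _ _) _; apply: le_trans (lerD H (normc_addle _ _)) _.
by rewrite !normcM normc_conj; lra.
Qed.

Lemma has_wirtinger_continuous F p A B :
  has_wirtinger F p A B -> continuous_atc F p.
Proof.
move=> /has_wirtinger_lip; set K := _ + _ + 1 => FK e e0.
have K0 : 0 < K by rewrite /K ltr_wpDl// addr_ge0// normc_ge0.
have eK : 0 < e / K by rewrite divr_gt0.
apply: nearc_sub (nearc_and FK (nearc_ball p eK)) => z [H1 H2].
apply: le_trans H1 _; rewrite mulrC -ler_pdivlMr//; exact: ltW.
Qed.

Lemma continuous_atc_mul F G p : continuous_atc F p -> continuous_atc G p ->
  continuous_atc (fun z => F z * G z) p.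
Proof.
move=> cF cG e e0; pose M := normc (F p) + normc (G p) + 1.
have M0 : 0 < M by rewrite /M ltr_wpDl// addr_ge0// normc_ge0.
pose a := Num.min 1 (e / M).
have a0 : 0 < a by rewrite lt_min ltr01 divr_gt0.
apply: nearc_sub (nearc_and (cF _ a0) (cG _ a0)) => z [H1 H2].
have -> : F z * G z - F p * G p =
  (F z - F p) * (G z - G p) + ((F z - F p) * G p + F p * (G z - G p)) by ring.
apply: le_trans (normc_addle _ _) _.
apply: le_trans (lerD (lexx _) (normc_addle _ _)) _; rewrite !normcM.
have a1 : a <= 1 by rewrite /a ge_min lexx.
have aM : a * M <= e by rewrite -ler_pdivlMr// /a ge_min lexx orbT.
have E1 := ler_pM (normc_ge0 _) (normc_ge0 _) H1 (le_trans H2 a1).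
have E2 := ler_wpM2r (normc_ge0 (G p)) H1.
have E3 := ler_wpM2l (normc_ge0 (F p)) H2.
apply: le_trans (lerD E1 (lerD E2 E3)) _.
by apply: le_trans aM; rewrite /M; lra.
Qed.

Lemma eq_has_wirtinger F G p A B : nearc p (fun z => F z = G z) ->
  has_wirtinger F p A B -> has_wirtinger G p A B.
Proof.
move=> FG HF e e0; have FGp : F p = G p.
  by have [r r0] := FG; apply; rewrite subrr normc0.
by apply: nearc_sub (nearc_and FG (HF e e0)) => z [<-]; rewrite -FGp.
Qed.

Lemma has_wirtinger_cst c p : has_wirtinger (fun=> c) p 0 0.
Proof.
move=> e e0; exists 1 => // z _.
by rewrite !mul0r addr0 !subr0 subrr normc0 mulr_ge0 ?(ltW e0)// normc_ge0.
Qed.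

Lemma has_wirtinger_id p : has_wirtinger id p 1 0.
Proof.
move=> e e0; exists 1 => // z _.
by rewrite mul0r mul1r addr0 subrr normc0 mulr_ge0 ?(ltW e0)// normc_ge0.
Qed.

Lemma has_wirtinger_conj p : has_wirtinger (fun z => conjc z) p 0 1.
Proof.
move=> e e0; exists 1 => // z _.
by rewrite mul0r mul1r add0r -raddfB/= subrr normc0 mulr_ge0 ?(ltW e0)// normc_ge0.
Qed.

Lemma has_wirtinger_add F G p A B A' B' :
  has_wirtinger F p A B -> has_wirtinger G p A' B' ->
  has_wirtinger (fun z => F z + G z) p (A + A') (B + B').
Proof.
move=> HF HG e e0; have e2 : 0 < e / 2 by rewrite divr_gt0.
apply: nearc_sub (nearc_and (HF _ e2) (HG _ e2)) => z [H1 H2].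
set h := z - p in H1 H2 *.
have -> : F z + G z - (F p + G p) - ((A + A') * h + (B + B') * conjc h) =
  (F z - F p - (A * h + B * conjc h)) + (G z - G p - (A' * h + B' * conjc h)) by ring.
apply: le_trans (normc_addle _ _) _; apply: le_trans (lerD H1 H2) _; lra.
Qed.

Lemma has_wirtinger_mul F G p A B A' B' :
  has_wirtinger F p A B -> has_wirtinger G p A' B' ->
  has_wirtinger (fun z => F z * G z) p (F p * A' + A * G p) (F p * B' + B * G p).
Proof.
move=> HF HG e e0.
have LF := has_wirtinger_lip HF; have LG := has_wirtinger_lip HG.
set K := _ + _ + 1 in LF; set K' := _ + _ + 1 in LG.
have K0 : 0 <= K by rewrite /K !addr_ge0// normc_ge0.
have K'0 : 0 <= K' by rewrite /K' !addr_ge0// normc_ge0.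
pose M := normc (F p) + normc (G p) + 1.
have M0 : 0 < M by rewrite /M ltr_wpDl// addr_ge0// normc_ge0.
have KK0 : 0 < K * K' + 1 by rewrite ltr_wpDl// mulr_ge0.
have e1 : 0 < e / 2 / M by rewrite !divr_gt0.
have r0 : 0 < e / 2 / (K * K' + 1) by rewrite !divr_gt0.
apply: nearc_sub (nearc_and (nearc_and LF LG)
  (nearc_and (nearc_and (HF _ e1) (HG _ e1)) (nearc_ball p r0))) =>
  z [[LFz LGz] [[H1 H2] zr]].
set h := z - p in H1 H2 zr LFz LGz *.
have -> : F z * G z - F p * G p -
   ((F p * A' + A * G p) * h + (F p * B' + B * G p) * conjc h) =
  (F z - F p - (A * h + B * conjc h)) * G p +
  F p * (G z - G p - (A' * h + B' * conjc h)) + (F z - F p) * (G z - G p) by ring.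
have h0 := normc_ge0 h.
have T1 : normc ((F z - F p) * (G z - G p)) <= e / 2 * normc h.
  rewrite normcM; apply: le_trans (ler_pM (normc_ge0 _) (normc_ge0 _) LFz LGz) _.
  have -> : K * normc h * (K' * normc h) = (K * K' * normc h) * normc h by ring.
  rewrite ler_wpM2r//; move: (ltW zr); rewrite ler_pdivlMr// => zr'.
  apply: le_trans zr'; rewrite mulrC ler_wpM2l//; lra.
have T2 : normc ((F z - F p - (A * h + B * conjc h)) * G p) +
  normc (F p * (G z - G p - (A' * h + B' * conjc h))) <= e / 2 * normc h.
  rewrite !normcM.
  apply: le_trans (lerD (ler_wpM2r (normc_ge0 _) H1) (ler_wpM2l (normc_ge0 _) H2)) _.
  have -> : e / 2 / M * normc h * normc (G p) + normc (F p) * (e / 2 / M * normc h) =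
    (e / 2 * normc h) * ((normc (F p) + normc (G p)) / M) by ring.
  rewrite -[leRHS]mulr1 ler_wpM2l//; first by rewrite mulr_ge0// ltW// divr_gt0.
  by rewrite ler_pdivrMr// mul1r /M lerDl.
apply: le_trans (normc_addle _ _) _; apply: le_trans (lerD (normc_addle _ _) T1) _.
apply: le_trans (lerD T2 (lexx _)) _; lra.
Qed.

Lemma has_wirtinger_comp (f u : C -> C) p D A B :
  has_wirtinger f (u p) D 0 -> has_wirtinger u p A B ->
  has_wirtinger (f \o u) p (D * A) (D * B).
Proof.
move=> Hf Hu e e0; have Lu := has_wirtinger_lip Hu.
set K := _ + _ + 1 in Lu.
have K0 : 0 < K by rewrite /K ltr_wpDl// addr_ge0// normc_ge0.
have D0 : 0 < normc D + 1 by rewrite ltr_wpDl// normc_ge0.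
have e1 : 0 < e / 2 / K by rewrite !divr_gt0.
have e2 : 0 < e / 2 / (normc D + 1) by rewrite !divr_gt0.
have [r r0 Hr] := Hf _ e1.
have r2 : 0 < r / 2 by rewrite divr_gt0.
apply: nearc_sub (nearc_and (has_wirtinger_continuous Hu r2) (nearc_and Lu (Hu _ e2)))
  => z [uz [Luz Hz]].
have {}Hr : normc (f (u z) - f (u p) - (D * (u z - u p) + 0 * conjc (u z - u p))) <=
    e / 2 / K * normc (u z - u p) by apply: Hr; apply: le_lt_trans uz _; lra.
rewrite mul0r addr0 in Hr; rewrite /=; set h := z - p in Luz Hz *.
have -> : f (u z) - f (u p) - (D * A * h + D * B * conjc h) =
  (f (u z) - f (u p) - D * (u z - u p)) + D * (u z - u p - (A * h + B * conjc h)).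
  by ring.
apply: le_trans (normc_addle _ _) _; rewrite normcM.
have h0 := normc_ge0 h.
have T1 : e / 2 / K * normc (u z - u p) <= e / 2 * normc h.
  rewrite -mulrA ler_wpM2l//; first by rewrite ltW// divr_gt0.
  by rewrite mulrC ler_pdivrMr// mulrC.
have T2 : normc D * normc (u z - u p - (A * h + B * conjc h)) <= e / 2 * normc h.
  apply: le_trans (ler_wpM2l (normc_ge0 _) Hz) _.
  have -> : normc D * (e / 2 / (normc D + 1) * normc h) =
    (e / 2 * normc h) * (normc D / (normc D + 1)) by ring.
  rewrite -[leRHS]mulr1 ler_wpM2l//; first by rewrite mulr_ge0// ltW// divr_gt0.
  by rewrite ler_pdivrMr// mul1r lerDl.
apply: le_trans (lerD (le_trans Hr T1) T2) _; lra.
Qed.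

Lemma has_wirtinger_quadratic F p A (K r : R) : 0 < r -> 0 <= K ->
  (forall z, normc (z - p) < r ->
     normc (F z - F p - A * (z - p)) <= K * normc (z - p) ^+ 2) ->
  has_wirtinger F p A 0.
Proof.
move=> r0 K0 H e e0; have eK : 0 < e / (K + 1) by rewrite divr_gt0// ltr_wpDl.
apply: nearc_sub (nearc_and (nearc_ball p r0) (nearc_ball p eK)) => z [zr ze].
rewrite mul0r addr0; apply: le_trans (H z zr) _.
rewrite expr2 mulrA ler_wpM2r ?normc_ge0//.
move: (ltW ze); rewrite ler_pdivlMr ?ltr_wpDl// => ze'; apply: le_trans ze'.
by rewrite mulrC ler_wpM2l ?normc_ge0// lerDl.
Qed.

Lemma has_wirtinger_cexp p : has_wirtinger (@cexp R) p (cexp p) 0.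
Proof.
apply: (@has_wirtinger_quadratic _ _ _ (normc (cexp p) * (4 * expR 1)) 1) => //.
  by rewrite !mulr_ge0 ?normc_ge0 ?expR_ge0.
move=> z z1.
have -> : cexp z = cexp p * cexp (z - p) by rewrite -cexpD addrC subrK.
have -> : cexp p * cexp (z - p) - cexp p - cexp p * (z - p) =
  cexp p * (cexp (z - p) - 1 - (z - p)) by ring.
rewrite normcM -!mulrA ler_wpM2l ?normc_ge0//.
apply: le_trans (normc_cexpB1B _) _.
rewrite [leRHS](_ : _ = 4 * normc (z - p) ^+ 2 * expR 1); last by ring.
by rewrite ler_wpM2l ?ler_expR ?(ltW z1)// mulr_ge0// sqr_ge0.
Qed.

Lemma has_wirtinger_inv w p : p != w ->
  has_wirtinger (fun z => (z - w)^-1) p (- (p - w)^-1 ^+ 2) 0.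
Proof.
move=> pw; have pw0 : p - w != 0 by rewrite subr_eq0.
have d0 : 0 < normc (p - w) by rewrite normc_gt0.
apply: (@has_wirtinger_quadratic _ _ _ (2 * (normc (p - w))^-1 ^+ 3)
  (normc (p - w) / 2)).
- by rewrite divr_gt0.
- by rewrite mulr_ge0// exprn_ge0// invr_ge0 ltW.
move=> z zr; have zw : normc (p - w) / 2 <= normc (z - w).
  have : normc (p - w) <= normc (z - w) + normc (z - p).
    have -> : p - w = (z - w) - (z - p) by ring.
    exact: normc_suble.
  by move: zr; lra.
have zw0 : z - w != 0 by rewrite -normc_gt0; apply: lt_le_trans zw; rewrite divr_gt0.
have -> : (z - w)^-1 - (p - w)^-1 - - (p - w)^-1 ^+ 2 * (z - p) =
   (z - w)^-1 * ((p - w)^-1 ^+ 2 * (z - p) ^+ 2) by field; rewrite zw0 pw0.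
rewrite normcM [X in _ * X <= _]normcM !normc_sqr !normcV.
have -> : 2 * (normc (p - w))^-1 ^+ 3 * normc (z - p) ^+ 2 =
  (normc (p - w) / 2)^-1 * ((normc (p - w))^-1 ^+ 2 * normc (z - p) ^+ 2).
  by field; rewrite gt_eqF.
apply: ler_wpM2r; first by rewrite mulr_ge0// sqr_ge0.
by rewrite lef_pV2// posrE ?divr_gt0// normc_gt0.
Qed.

End wirtinger.

(** * Continuous functions are measurable for the product sigma-algebra *)

Section continuous_measurable.
Variable R : realType.
Notation plane := (measurableTypeR R * measurableTypeR R)%type.

Lemma measurable_floor_mulr (k : R) (m : int) :
  measurable [set x : measurableTypeR R | Num.floor (x * k) = m].
Proof.
have mk : measurable_fun setT (fun x : measurableTypeR R => x * k).
  by apply: measurable_funM => //; exact: measurable_cst.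
have := mk measurableT `[m%:~R, (m + 1)%:~R[%classic (measurable_itv _).
rewrite setTI; congr measurable; apply/seteqP; split => x /=; rewrite in_itv/=.
  by move/floor_def.
by move=> <-; rewrite floor_le floorD1_gt.
Qed.

(** The sigma-algebra on tuples is generated by the coordinates, so that open sets
    have to be reached from boxes: f is the pointwise limit of the functions
    obtained by rounding the coordinates down to multiples of 1 / (k + 1), and each
    of these is constant on the cells of a countable partition into boxes. *)
Lemma measurable_continuous_tuple n (f : n.-tuple plane -> R) :
  (forall (t : n.-tuple plane) (e : R), 0 < e -> exists2 r : R, 0 < r &
    forall t' : n.-tuple plane, (forall i, `|(tnth t' i).1 - (tnth t i).1| < r /\
                     `|(tnth t' i).2 - (tnth t i).2| < r) -> `|f t' - f t| <= e) ->
  measurable_fun setT f.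
Proof.
move=> cf.
pose K k : R := k.+1%:R.
have K0 k : 0 < K k by rewrite /K.
pose cell k (t : n.-tuple plane) : n.-tuple (int * int) :=
  [tuple (Num.floor ((tnth t i).1 * K k), Num.floor ((tnth t i).2 * K k)) | i < n].
pose pt k (s : n.-tuple (int * int)) : n.-tuple plane :=
  [tuple ((tnth s i).1%:~R / K k, (tnth s i).2%:~R / K k) | i < n].
have mcell k s : measurable [set t | cell k t = s].
  have -> : [set t | cell k t = s] = \bigcap_(i in [set: 'I_n])
    ((fun t => tnth t i) @^-1` ([set x | Num.floor (x * K k) = (tnth s i).1] `*`
       [set y | Num.floor (y * K k) = (tnth s i).2])).
    apply/seteqP; split => t /=.
      by move=> <- i _; rewrite tnth_mktuple.
    move=> H; apply: eq_from_tnth => i; have [/= H1 H2] := H i I.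
    by rewrite tnth_mktuple H1 H2; case: (tnth s i).
  apply: fin_bigcap_measurable => // i _; rewrite -[X in measurable X]setTI.
  by apply: measurable_tnth => //; apply: measurableX; exact: measurable_floor_mulr.
apply: (@measurable_fun_cvg _ _ _ setT (fun k => f \o pt k \o cell k)).
  move=> k _ Y mY; rewrite setTI.
  have -> : (f \o pt k \o cell k) @^-1` Y = \bigcup_(s : n.-tuple (int * int))
     (if asbool (Y (f (pt k s))) then [set t | cell k t = s] else set0).
    apply/seteqP; split => t /=.
      by move=> Yt; exists (cell k t) => //; rewrite ifT//; apply/asboolP.
    by move=> [s _]; case: ifPn => [/asboolP Ys /= -> //|].
  apply: countable_bigcupT_measurable; first exact: countableP.
  by move=> s; case: ifP.
move=> t _; apply/cvgrPdist_le => e e0; have [r r0 H] := cf t e e0.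
exists (Num.bound r^-1) => // k /= kr; rewrite distrC; apply: H => i.
have near x : `|(Num.floor (x * K k))%:~R / K k - x| < r.
  have Kr : (K k)^-1 < r.
    rewrite -[ltRHS]invrK ltf_pV2 ?posrE ?invr_gt0//.
    apply: lt_le_trans (archi_boundP _) _; first by rewrite invr_ge0 ltW.
    by rewrite /K ler_nat ltnW.
  apply: le_lt_trans Kr; have -> : (Num.floor (x * K k))%:~R / K k - x =
    - (x * K k - (Num.floor (x * K k))%:~R) / K k by field; rewrite gt_eqF.
  rewrite normrM normrN [X in _ * X]ger0_norm ?invr_ge0 ?(ltW (K0 k))//.
  rewrite -[leRHS]mul1r ler_wpM2r ?invr_ge0 ?(ltW (K0 k))//.
  have := floor_le (x * K k); have := floorD1_gt (x * K k).
  rewrite intrD; set u := _%:~R => h1 h2; rewrite ler_norml; apply/andP; split; lra.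
by rewrite /= !tnth_mktuple /=; split; exact: near.
Qed.

End continuous_measurable.

(** * Integrals of complex functions *)

Section complex_integral.
Context d (T : measurableType d) (R : realType).
Variable mu : {measure set T -> \bar R}.
Local Notation C := R[i].
Implicit Types f g : T -> C.

Definition cintegrable f : Prop :=
  mu.-integrable setT (EFin \o (fun x => complex.Re (f x))) /\
  mu.-integrable setT (EFin \o (fun x => complex.Im (f x))).

Definition cintegral f : C :=
  (\int[mu]_x complex.Re (f x)) +i* (\int[mu]_x complex.Im (f x)).

Lemma eq_cintegrable f g : f =1 g -> cintegrable f -> cintegrable g.
Proof. by move=> /funext ->. Qed.

Lemma eq_cintegral f g : f =1 g -> cintegral f = cintegral g.
Proof. by move=> /funext ->. Qed.

Lemma cintegrable_add f g : cintegrable f -> cintegrable g ->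
  cintegrable (fun x => f x + g x).
Proof.
move=> [f1 f2] [g1 g2]; split.
  have -> : (fun x => complex.Re (f x + g x)) =
    (fun x => complex.Re (f x) + complex.Re (g x)) by apply/funext => x; rewrite Re_add.
  exact: integrable_addR.
have -> : (fun x => complex.Im (f x + g x)) =
  (fun x => complex.Im (f x) + complex.Im (g x)) by apply/funext => x; rewrite Im_add.
exact: integrable_addR.
Qed.

Lemma cintegral_add f g : cintegrable f -> cintegrable g ->
  cintegral (fun x => f x + g x) = cintegral f + cintegral g.
Proof.
move=> [f1 f2] [g1 g2]; apply: eqc_ReIm; rewrite ReImE/= -RintegralD//.
  by apply: eq_Rintegral => x _; rewrite Re_add.
by apply: eq_Rintegral => x _; rewrite Im_add.
Qed.

Lemma cintegrable_scale (c : C) f : cintegrable f -> cintegrable (fun x => c * f x).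
Proof.
move=> [f1 f2]; split.
  have -> : (fun x => complex.Re (c * f x)) = (fun x =>
    complex.Re c * complex.Re (f x) - complex.Im c * complex.Im (f x)).
    by apply/funext => x; rewrite Re_mul.
  by apply: integrable_subR => //; exact: integrable_scaleR.
have -> : (fun x => complex.Im (c * f x)) = (fun x =>
  complex.Re c * complex.Im (f x) + complex.Im c * complex.Re (f x)).
  by apply/funext => x; rewrite Im_mul.
by apply: integrable_addR => //; exact: integrable_scaleR.
Qed.

Lemma cintegral_scale (c : C) f : cintegrable f ->
  cintegral (fun x => c * f x) = c * cintegral f.
Proof.
move=> [f1 f2]; have scl k h : mu.-integrable setT (EFin \o h) ->
    mu.-integrable setT (EFin \o (fun x => k * h x : R)).
  exact: integrable_scaleR.
apply: eqc_ReIm; rewrite ReImE/= -!RintegralZl// -?RintegralB -?RintegralD//;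
  try exact: scl.
  by apply: eq_Rintegral => x _; rewrite Re_mul.
by apply: eq_Rintegral => x _; rewrite Im_mul.
Qed.

Lemma cintegrable_sub f g : cintegrable f -> cintegrable g ->
  cintegrable (fun x => f x - g x).
Proof.
move=> fi gi; apply: eq_cintegrable (cintegrable_add fi (cintegrable_scale (-1) gi)).
by move=> x; rewrite mulN1r.
Qed.

Lemma cintegral_sub f g : cintegrable f -> cintegrable g ->
  cintegral (fun x => f x - g x) = cintegral f - cintegral g.
Proof.
move=> fi gi; rewrite -[in RHS]mulN1r -cintegral_scale// -cintegral_add//.
  by apply: eq_cintegral => x; rewrite mulN1r.
exact: cintegrable_scale.
Qed.

Lemma cintegrable_conj f : cintegrable f -> cintegrable (fun x => conjc (f x)).
Proof.
move=> [f1 f2]; split.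
  by have -> : (fun x => complex.Re (conjc (f x))) = (fun x => complex.Re (f x))
    by apply/funext => x; rewrite Re_conj.
have -> : (fun x => complex.Im (conjc (f x))) = (fun x => -1 * complex.Im (f x)).
  by apply/funext => x; rewrite Im_conj mulN1r.
exact: integrable_scaleR.
Qed.

Lemma cintegral_conj f : cintegrable f ->
  cintegral (fun x => conjc (f x)) = conjc (cintegral f).
Proof.
move=> [f1 f2]; apply: eqc_ReIm; rewrite ReImE/=.
  by apply: eq_Rintegral => x _; rewrite Re_conj.
rewrite -mulN1r -RintegralZl//.
by apply: eq_Rintegral => x _; rewrite Im_conj mulN1r.
Qed.

Lemma le_cintegrable f (h : T -> R) :
  measurable_fun setT (fun x => complex.Re (f x)) ->
  measurable_fun setT (fun x => complex.Im (f x)) ->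
  (forall x, normc (f x) <= h x) -> mu.-integrable setT (EFin \o h) ->
  cintegrable f.
Proof.
move=> m1 m2 fh hi; split; apply: (le_integrableR _ _ _ hi) => // x _.
  exact: le_trans (Re_le_normc _) (fh x).
exact: le_trans (Im_le_normc _) (fh x).
Qed.

Lemma cintegrable_measurable f : cintegrable f ->
  measurable_fun setT (fun x => complex.Re (f x)) /\
  measurable_fun setT (fun x => complex.Im (f x)).
Proof.
by move=> [f1 f2]; split; apply/measurable_EFinP; [exact: measurable_int f1|
  exact: measurable_int f2].
Qed.

Lemma cintegrable_normc f : cintegrable f ->
  mu.-integrable setT (EFin \o (fun x => normc (f x))).
Proof.
move=> fi; have [f1 f2] := fi; have [m1 m2] := cintegrable_measurable fi.
have := integrable_addR measurableT (integrable_norm f1)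
  (integrable_norm f2).
apply: le_integrableR => //.
  have -> : (fun x => normc (f x)) =
    (fun x => Num.sqrt (complex.Re (f x) ^+ 2 + complex.Im (f x) ^+ 2)).
    by apply/funext => x; rewrite -sqr_normc sqrtr_sqr ger0_norm// normc_ge0.
  have m12 : measurable_fun setT
      ((fun x => complex.Re (f x) ^+ 2) \+ (fun x => complex.Im (f x) ^+ 2)).
    by apply: measurable_funD; exact: measurable_funX.
  have msqrt : measurable_fun [set: R] (@Num.sqrt R).
    by apply: continuous_measurable_fun; exact: sqrt_continuous.
  exact: (measurableT_comp msqrt m12).
by move=> x _; rewrite ger0_norm ?normc_ge0// normc_le_ReIm.
Qed.

Lemma normc_cintegral_le f (h : T -> R) : cintegrable f ->
  mu.-integrable setT (EFin \o h) -> (forall x, normc (f x) <= h x) ->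
  normc (cintegral f) <= 2 * \int[mu]_x h x.
Proof.
move=> [f1 f2] hi fh; apply: le_trans (normc_le_ReIm _) _ => /=.
have H k : mu.-integrable setT (EFin \o k) -> (forall x, `|k x : R| <= h x) ->
    `|\int[mu]_x k x| <= \int[mu]_x h x.
  move=> ki kh; apply: le_trans (le_normr_Rintegral _ ki) _ => //.
  by apply: le_Rintegral => //; exact: integrable_norm.
rewrite mulr_natl mulr2n; apply: lerD; apply: H => // x.
  exact: le_trans (Re_le_normc _) (fh x).
exact: le_trans (Im_le_normc _) (fh x).
Qed.

End complex_integral.

(** * Gaussian integrals in the plane *)

Section gaussian_integrals.
Variable R : realType.
Notation mu := (@lebesgue_measure R).
Notation lam := (lebesgue_plane R).
Notation plane := (measurableTypeR R * measurableTypeR R)%type.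

Lemma integral_gauss_line (a : R) : 0 < a ->
  (\int[mu]_x (expR (- (a * x ^+ 2)))%:E = (Num.sqrt (pi / a))%:E)%E.
Proof.
move=> a0; pose s : R := Num.sqrt (2 * a)^-1.
have s2 : s ^+ 2 = (2 * a)^-1 by rewrite sqr_sqrtr// invr_ge0 mulr_ge0// ltW.
have s0 : s != 0 by rewrite gt_eqF// sqrtr_gt0 invr_gt0 mulr_gt0.
have sa : Num.sqrt (s ^+ 2 * pi *+ 2) = Num.sqrt (pi / a).
  by congr Num.sqrt; rewrite s2 -mulr_natr; field; rewrite gt_eqF.
have pa : 0 < Num.sqrt (pi / a) by rewrite sqrtr_gt0 divr_gt0// pi_gt0.
have E x : expR (- (a * x ^+ 2)) = Num.sqrt (pi / a) * normal_pdf 0 s x.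
  have -> : normal_pdf 0 s x = normal_peak s * normal_fun 0 s x by rewrite normal_pdfE.
  rewrite /normal_peak sa [RHS]mulrA divff ?gt_eqF// mul1r.
  rewrite /normal_fun s2 subr0; congr expR; rewrite -mulr_natr; field.
  by rewrite gt_eqF.
under eq_integral do rewrite E EFinM.
rewrite integralZl//; last exact: integrable_normal_pdf.
by rewrite integral_normal_pdf mule1.
Qed.

Definition plane_point (z : plane) : R[i] := z.1 +i* z.2.

Lemma integral_gauss_plane (a : R) : 0 < a ->
  (\int[lam]_z (expR (- (a * normc (plane_point z) ^+ 2)))%:E = (pi / a)%:E)%E.
Proof.
move=> a0.
pose h (z : plane) := ((expR (- (a * z.1 ^+ 2)))%:E * (expR (- (a * z.2 ^+ 2)))%:E)%E.
have mh : measurable_fun [set: measurableTypeR R] (fun x => (expR (- (a * x ^+ 2)))%:E).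
  apply/measurable_EFinP; apply: measurableT_comp => //.
  apply: measurableT_comp => //; exact: measurable_funM.
have -> : (fun z : plane => (expR (- (a * normc (plane_point z) ^+ 2)))%:E) = h.
  apply/funext => z; rewrite /h -EFinM -expRD sqr_normc/=; congr (expR _)%:E.
  by rewrite mulrDr opprD.
transitivity (\int[(mu \x mu)%E]_z h z)%E; first by [].
rewrite (fubini_tonelli1 h); last 2 first.
- apply: emeasurable_funM.
    exact: (measurableT_comp mh measurable_fst).
  exact: (measurableT_comp mh measurable_snd).
- by move=> z; rewrite /h mule_ge0// lee_fin expR_ge0.
rewrite /fubini_F /h /=.
under eq_integral do rewrite ge0_integralZl// ?lee_fin ?expR_ge0//
  integral_gauss_line//.
rewrite ge0_integralZr; [|exact: measurableT|exact: mh|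
  by move=> x _; rewrite lee_fin expR_ge0|by rewrite lee_fin sqrtr_ge0].
rewrite integral_gauss_line// -EFinM -expr2 sqr_sqrtr// divr_ge0 ?pi_ge0// ltW//.
Qed.

Lemma measurable_continuous_plane (F : R[i] -> R) :
  (forall p (e : R), 0 < e -> nearc p (fun z => `|F z - F p| <= e)) ->
  measurable_fun setT (fun z : plane => F (plane_point z)).
Proof.
move=> cF; pose f (t : 1.-tuple plane) := F (plane_point (tnth t ord0)).
have mf : measurable_fun setT f.
  apply: measurable_continuous_tuple => t e e0.
  have [r r0 H] := cF (plane_point (tnth t ord0)) e e0.
  exists (r / 2); first by rewrite divr_gt0.
  move=> t' /(_ ord0)[H1 H2]; apply: H; apply: le_lt_trans (normc_le_ReIm _) _.
  rewrite !ReImE/=; lra.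
have mc : measurable_fun setT (fun z : plane => [the 1.-tuple plane of [tuple z]]).
  apply/measurable_fun_tnthP => i; rewrite (ord1 i)/=.
  exact: measurable_id.
exact: (@measurableT_comp _ _ _ _ _ _ f _ _ mf mc).
Qed.

Lemma measurable_continuous_planec (F : R[i] -> R[i]) :
  (forall p, continuous_atc F p) ->
  measurable_fun setT (fun z => complex.Re (F (plane_point z))) /\
  measurable_fun setT (fun z => complex.Im (F (plane_point z))).
Proof.
move=> cF; split.
  apply: (@measurable_continuous_plane (fun z => complex.Re (F z))) => p e e0.
  apply: nearc_sub (cF p e e0) => z; apply: le_trans.
  by rewrite -Re_opp -Re_add Re_le_normc.
apply: (@measurable_continuous_plane (fun z => complex.Im (F z))) => p e e0.
apply: nearc_sub (cF p e e0) => z; apply: le_trans.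
by rewrite -Im_opp -Im_add Im_le_normc.
Qed.

Lemma integrable_gauss_plane (a : R) : 0 < a ->
  lam.-integrable setT (EFin \o (fun z => expR (- (a * normc (plane_point z) ^+ 2)))).
Proof.
move=> a0; apply/integrableP; split.
  apply/measurable_EFinP.
  have [m1 m2] := @measurable_continuous_planec id
    (fun p => has_wirtinger_continuous (has_wirtinger_id p)).
  apply: measurableT_comp => //; apply: measurableT_comp => //.
  apply: measurable_funM => //.
  under eq_fun do rewrite sqr_normc.
  by apply: measurable_funD; exact: measurable_funX.
under eq_integral do rewrite /= ger0_norm ?expR_ge0//.
by rewrite integral_gauss_plane// ltry.
Qed.

End gaussian_integrals.

(** * Integrals of conjugate derivatives over the plane *)

Section dbar_plane.
Variable R : realType.
Notation mu := (@lebesgue_measure R).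
Notation lam := (lebesgue_plane R).
Notation plane := (measurableTypeR R * measurableTypeR R)%type.
Local Notation C := R[i].

Lemma continuous_atc_vertical (F : C -> C) (x : R) : (forall p, continuous_atc F p) ->
  continuous (fun y => complex.Re (F (x +i* y))) /\
  continuous (fun y => complex.Im (F (x +i* y))).
Proof.
move=> cF; split => y; apply/cvgrPdist_le => e e0;
  have [r r0 H] := cF (x +i* y) e e0; exists r => //= y' yy'; rewrite distrC;
  rewrite -?Re_opp -?Re_add -?Im_opp -?Im_add.
  apply: le_trans (Re_le_normc _) _; apply: H.
  by apply: le_lt_trans (normc_le_ReIm _) _; rewrite !ReImE/= subrr normr0 add0r distrC.
apply: le_trans (Im_le_normc _) _; apply: H.
by apply: le_lt_trans (normc_le_ReIm _) _; rewrite !ReImE/= subrr normr0 add0r distrC.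
Qed.

Lemma continuous_atc_horizontal (F : C -> C) (y : R) : (forall p, continuous_atc F p) ->
  continuous (fun x => complex.Re (F (x +i* y))) /\
  continuous (fun x => complex.Im (F (x +i* y))).
Proof.
move=> cF; split => x; apply/cvgrPdist_le => e e0;
  have [r r0 H] := cF (x +i* y) e e0; exists r => //= x' xx'; rewrite distrC;
  rewrite -?Re_opp -?Re_add -?Im_opp -?Im_add.
  apply: le_trans (Re_le_normc _) _; apply: H.
  by apply: le_lt_trans (normc_le_ReIm _) _; rewrite !ReImE/= subrr normr0 addr0 distrC.
apply: le_trans (Im_le_normc _) _; apply: H.
by apply: le_lt_trans (normc_le_ReIm _) _; rewrite !ReImE/= subrr normr0 addr0 distrC.
Qed.

(** The field (Re F, - Im F) has divergence twice the real part of dF/dconj(z). *)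
Lemma Rintegral_dbar (F H : C -> C) (w : C) :
  (forall p, continuous_atc F p) -> (forall p, continuous_atc H p) ->
  (forall p, p != w -> exists A, has_wirtinger F p A (H p)) ->
  cintegrable lam (F \o @plane_point R) -> cintegrable lam (H \o @plane_point R) ->
  \int[lam]_z complex.Re (H (plane_point z)) = 0.
Proof.
move=> cF cH dF [iF1 iF2] [iH1 iH2].
pose P x y := complex.Re (F (x +i* y)).
pose Q x y := - complex.Im (F (x +i* y)).
pose G (z : plane) := 2 * complex.Re (H (plane_point z)).
have iG : lam.-integrable setT (EFin \o G) by exact: integrable_scaleR.
suff : \int[lam]_z G z = 0.
  by rewrite /G RintegralZl// => /eqP; rewrite mulf_eq0 pnatr_eq0/= => /eqP.
have near1 (p q : R) (r : R) : 0 < r -> forall x y, `|x - p| < r / 2 -> `|y - q| < r / 2 ->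
    normc ((x +i* y) - (p +i* q)) < r.
  move=> r0 x y xp yq; apply: le_lt_trans (normc_le_ReIm _) _; rewrite !ReImE/=.
  by rewrite [ltRHS](splitr r) ltrD.
apply: (@divergence_plane R P Q G _ _ iG (complex.Re w) (complex.Im w)).
- by move=> x; exact: (continuous_atc_vertical x cF).1.
- move=> y x; exact: (cvgN ((continuous_atc_horizontal y cF).2 x)).
- move=> p q pq; have /dF[A FA] : (p +i* q : C) != w by rewrite eq_complex negb_and.
  set B := H (p +i* q) in FA.
  exists (complex.Re (A + B)), (- complex.Im (A - B)), (- complex.Im (A + B)), (- complex.Re (A - B)).
  split; first by rewrite /G /plane_point /= -/B !ReImE; ring.
  move=> e e0; have e2 : 0 < e / 2 by rewrite divr_gt0.
  have [r r0 Hr] := nearc_and (FA e e0) (cH (p +i* q) _ e2).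
  exists (r / 2) => [|x y xp yq]; first by rewrite divr_gt0.
  have [H1 H2] := Hr _ (near1 p q r r0 x y xp yq).
  have hle : normc ((x +i* y) - (p +i* q)) <= `|x - p| + `|y - q|.
    by apply: le_trans (normc_le_ReIm _) _; rewrite !ReImE.
  have {}H1 := le_trans H1 (ler_wpM2l (ltW e0) hle).
  split.
  + apply: le_trans H1; apply: le_trans _ (Re_le_normc _).
    by rewrite le_eqVlt /P !ReImE/=; apply/orP; left; apply/eqP; congr `|_|; ring.
  + apply: le_trans H1; apply: le_trans _ (Im_le_normc _).
    rewrite -[leRHS]normrN.
    by rewrite le_eqVlt /Q !ReImE/=; apply/orP; left; apply/eqP; congr `|_|; ring.
  + rewrite /G /plane_point/= -mulrBr normrM ger0_norm// mulrC -ler_pdivlMr//.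
    by apply: le_trans H2; rewrite -Re_opp -Re_add Re_le_normc.
- have [r r0 Hr] := nearc_and (cF w 1 ltr01) (cH w 1 ltr01).
  exists (2 * (normc (F w) + normc (H w) + 1)), (r / 2); split.
  + by rewrite mulr_ge0// !addr_ge0// normc_ge0.
  + by rewrite divr_gt0.
  move=> x y xp yq; have wE : w = complex.Re w +i* complex.Im w by case: (w).
  have := near1 _ _ r r0 x y xp yq; rewrite -wE => /Hr[H1 H2].
  have F1 : normc (F (x +i* y)) <= normc (F w) + 1.
    rewrite -[F (x +i* y)](subrK (F w)) addrC; apply: le_trans (normc_addle _ _) _.
    by rewrite lerD2l.
  have G1 : normc (H (x +i* y)) <= normc (H w) + 1.
    rewrite -[H (x +i* y)](subrK (H w)) addrC; apply: le_trans (normc_addle _ _) _.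
    by rewrite lerD2l.
  have := normc_ge0 (F w); have := normc_ge0 (H w) => h0 f0.
  split.
  + by apply: le_trans (Re_le_normc _) _; lra.
  + by rewrite /Q normrN; apply: le_trans (Im_le_normc _) _; lra.
  + rewrite /G normrM ger0_norm// ler_wpM2l//.
    by apply: le_trans (Re_le_normc _) _; rewrite /plane_point/=; lra.
- by [].
- rewrite /Q; have := integrable_scaleR (-1) measurableT iF2.
  by apply: eq_integrable => // z _ /=; rewrite mulN1r.
Qed.

(** The imaginary part of H is the real part of - i H, the conjugate derivative
    of - i F. *)
Lemma cintegral_dbar (F H : C -> C) (w : C) :
  (forall p, continuous_atc F p) -> (forall p, continuous_atc H p) ->
  (forall p, p != w -> exists A, has_wirtinger F p A (H p)) ->
  cintegrable lam (F \o @plane_point R) -> cintegrable lam (H \o @plane_point R) ->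
  cintegral lam (H \o @plane_point R) = 0.
Proof.
move=> cF cH dF iF iH; apply: eqc_ReIm; first exact: (Rintegral_dbar cF cH dF).
have ci (K : C -> C) : (forall p, continuous_atc K p) ->
    forall p, continuous_atc (fun z => - 'i * K z) p.
  move=> cK p e e0; apply: nearc_sub (cK p e e0) => z; apply: le_trans.
  by rewrite -mulrBr normcM normc_opp /= expr0n/= add0r expr1n sqrtr1 mul1r.
have := Rintegral_dbar (ci F cF) (ci H cH) _
  (cintegrable_scale (- 'i) iF) (cintegrable_scale (- 'i) iH) (w := w).
rewrite /= => E; rewrite -[RHS]E; last first.
  move=> p /dF[A FA]; have := has_wirtinger_mul (has_wirtinger_cst (- 'i) p) FA.
  by rewrite !mul0r !addr0 => ?; eexists; eassumption.
by apply: eq_Rintegral => z _; rewrite !ReImE/=; ring.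
Qed.

End dbar_plane.

(** * The reproducing formula in one variable *)

Section gaussian_mean.
Variable R : realType.
Notation lam := (lebesgue_plane R).
Notation plane := (measurableTypeR R * measurableTypeR R)%type.
Local Notation C := R[i].
Notation pt := (@plane_point R).

(** This is exp (w conj(z) / 2) exp (- |z|^2 / 2), the conjugate of the reproducing
    kernel at w times the Gaussian weight. It is written so that its derivative in
    conj(z) has the visible factor z - w. *)
Definition gauss_kernel (w z : C) : C := cexp (- ((z - w) * conjc z / 2)).

Lemma half_complex : (2^-1 : C) = (2^-1)%:C.
Proof. by rewrite fmorphV/= rmorph_nat. Qed.

Lemma normc_gauss_kernel (w z : C) : normc (gauss_kernel w z) <=
  expR (normc w ^+ 2 / 4) * expR (- (4^-1 * normc z ^+ 2)).
Proof.
rewrite /gauss_kernel normc_cexp -expRD ler_expR !sqr_normc half_complex !ReImE/=.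
set a := complex.Re z; set b := complex.Im z; set c := complex.Re w; set d := complex.Im w.
rewrite -subr_ge0 [X in 0 <= X](_ : _ = ((a - c) ^+ 2 + (b - d) ^+ 2) / 4); last by field.
by rewrite divr_ge0// addr_ge0// sqr_ge0.
Qed.

Lemma has_wirtinger_ex (F G : C -> C) (p A B B' : C) :
  has_wirtinger F p A B -> F =1 G -> B = B' ->
  exists A', has_wirtinger G p A' B'.
Proof. by move=> HF /funext <- <-; exists A. Qed.

Lemma has_wirtinger_gauss_kernel (w p : C) : exists A,
  has_wirtinger (gauss_kernel w) p A (gauss_kernel w p * (- ((p - w) / 2))).
Proof.
have u1 := has_wirtinger_add (has_wirtinger_id p) (has_wirtinger_cst (- w) p).
have u2 := has_wirtinger_mul (has_wirtinger_cst (- 2^-1) p)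
  (has_wirtinger_mul u1 (has_wirtinger_conj p)).
have uE z : - 2^-1 * ((z + - w) * conjc z) = - ((z - w) * conjc z / 2) by ring.
have H := has_wirtinger_comp (has_wirtinger_cexp _) u2.
apply: (has_wirtinger_ex H) => [z|]; last first.
  rewrite /= uE -/(gauss_kernel w p); set k := gauss_kernel w p.
  by ring.
by rewrite /= uE.
Qed.

Lemma continuous_gauss_kernel (w p : C) : continuous_atc (gauss_kernel w) p.
Proof.
by have [A /has_wirtinger_continuous] := has_wirtinger_gauss_kernel w p.
Qed.

Lemma cintegrable_gauss_kernel (w : C) : cintegrable lam (gauss_kernel w \o pt).
Proof.
have [m1 m2] := measurable_continuous_planec (continuous_gauss_kernel w).
apply: (le_cintegrable (h := fun z => expR (normc w ^+ 2 / 4) *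
  expR (- (4^-1 * normc (pt z) ^+ 2)))) => //.
  by move=> z; exact: normc_gauss_kernel.
apply: integrable_scaleR => //; apply: integrable_gauss_plane.
by rewrite invr_gt0.
Qed.

Definition entire1 (g : C -> C) : Prop := forall p, exists A, has_wirtinger g p A 0.

(** Let q be the difference quotient of g at w. Away from w, q is holomorphic, so
    the conjugate derivative of q times the kernel is q times that of the kernel,
    which is - (g - g w) / 2 times the kernel. At w, q is merely known to be
    continuous: this is the exceptional point of [divergence_plane]. *)
Lemma cintegral_entire_gauss_kernel (g : C -> C) (w : C) : entire1 g ->
  cintegrable lam (fun z => g (pt z) * gauss_kernel w (pt z)) ->
  cintegral lam (fun z => g (pt z) * gauss_kernel w (pt z)) =
  g w * cintegral lam (gauss_kernel w \o pt).
Proof.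
move=> ge gi; have [D gD] := ge w; have psi_i := cintegrable_gauss_kernel w.
pose q z := if z == w then D else (g z - g w) * (z - w)^-1.
pose F z := q z * gauss_kernel w z.
pose H z := - 2^-1 * (g z * gauss_kernel w z - g w * gauss_kernel w z).
have dq p : p != w -> exists A, has_wirtinger q p A 0.
  move=> pw; have [A gA] := ge p.
  have Hq := has_wirtinger_mul (has_wirtinger_add gA (has_wirtinger_cst (- g w) p))
    (has_wirtinger_inv pw).
  have [A' qA'] : exists A', has_wirtinger (fun z => (g z - g w) * (z - w)^-1) p A' 0.
    apply: (has_wirtinger_ex Hq) => //; ring.
  exists A'; apply: eq_has_wirtinger qA'.
  have pw0 : 0 < normc (p - w) by rewrite normc_gt0 subr_eq0.
  exists (normc (p - w)) => // z; rewrite normc_subC /q; case: eqP => // -> .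
  by rewrite ltxx.
have dF p : p != w -> exists A, has_wirtinger F p A (H p).
  move=> pw; have [A qA] := dq p pw; have [A' kA'] := has_wirtinger_gauss_kernel w p.
  apply: (has_wirtinger_ex (has_wirtinger_mul qA kA')) => //.
  rewrite /H /q (negPf pw); field.
  by rewrite subr_eq0 pw.
have q_near e : 0 < e -> nearc w (fun z => normc (q z - D) <= e).
  move=> e0; apply: nearc_sub (gD e e0) => z; rewrite /q.
  have [->|zw] := eqVneq z w; first by rewrite (subrr D) normc0 (ltW e0).
  have zw0 : 0 < normc (z - w) by rewrite normc_gt0 subr_eq0.
  rewrite mul0r addr0 => Hz; rewrite -(ler_pM2r zw0) -normcM.
  by apply: le_trans Hz; rewrite mulrBl divfK// subr_eq0.
have cq p : continuous_atc q p.
  have [->|pw] := eqVneq p w; last first.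
    by have [A /has_wirtinger_continuous] := dq p pw.
  by move=> e e0; rewrite {2}/q eqxx; exact: q_near.
have cF p : continuous_atc F p.
  exact: continuous_atc_mul (cq p) (continuous_gauss_kernel w p).
have cH p : continuous_atc H p.
  have [A gA] := ge p; have [A' kA'] := has_wirtinger_gauss_kernel w p.
  have Hc := has_wirtinger_mul (has_wirtinger_cst (- 2^-1) p)
    (has_wirtinger_mul (has_wirtinger_add gA (has_wirtinger_cst (- g w) p)) kA').
  apply: has_wirtinger_continuous; apply: eq_has_wirtinger Hc.
  by exists 1 => // z _; rewrite /H mulrBl.
have gwi := cintegrable_scale (g w) psi_i.
have diff_i := cintegrable_sub gi gwi.
have iH : cintegrable lam (H \o pt) by apply: eq_cintegrable (cintegrable_scale (- 2^-1) diff_i).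
have iF : cintegrable lam (F \o pt).
  have [m1 m2] := measurable_continuous_planec cF.
  have [r r0 qr] := q_near 1 ltr01.
  have h1 := cintegrable_normc psi_i; have h2 := cintegrable_normc diff_i.
  apply: (le_cintegrable m1 m2 (h := fun z => (normc D + 1) * normc (gauss_kernel w (pt z)) +
     r^-1 * normc (g (pt z) * gauss_kernel w (pt z) - g w * gauss_kernel w (pt z)))); last first.
    by apply: integrable_addR => //; exact: integrable_scaleR.
  move=> z /=; rewrite /F -mulrBl !normcM.
  set k := normc (gauss_kernel w _); have k0 : 0 <= k by exact: normc_ge0.
  (* near w the quotient is bounded by |D| + 1, elsewhere by |g - g w| / r *)
  have [zr|rz] := ltP (normc (pt z - w)) r.
    rewrite -[leLHS]addr0; apply: lerD.
      rewrite ler_wpM2r//; have := qr _ zr => H1.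
      rewrite -[q _](subrK D) addrC; apply: le_trans (normc_addle _ _) _.
      by rewrite lerD2l.
    by rewrite mulr_ge0 ?invr_ge0 ?(ltW r0)// mulr_ge0 ?normc_ge0.
  rewrite -[leLHS]add0r; apply: lerD.
    by rewrite mulr_ge0// addr_ge0// normc_ge0.
  have zw : pt z != w.
    by apply/eqP => E; move: rz; rewrite E subrr normc0 leNgt r0.
  rewrite /q (negPf zw) normcM normcV mulrA ler_wpM2r// mulrC ler_wpM2r ?normc_ge0//.
  by rewrite lef_pV2// posrE// (lt_le_trans r0).
have := cintegral_dbar cF cH dF iF iH.
rewrite (eq_cintegral _ (g := fun z => - 2^-1 * (g (pt z) * gauss_kernel w (pt z) -
  g w * gauss_kernel w (pt z))))//.
rewrite cintegral_scale// cintegral_sub// (cintegral_scale (g w) psi_i) => /eqP.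
by rewrite mulf_eq0 oppr_eq0 invr_eq0 pnatr_eq0/= subr_eq0 => /eqP.
Qed.

(** For w = 0 this is a Gaussian integral. In general the conjugate of the kernel
    is the kernel at 0 times the entire function exp (conj(w) z / 2), whose mean is
    its value at 0 by [cintegral_entire_gauss_kernel]. *)
Lemma cintegral_gauss_kernel (w : C) : cintegral lam (gauss_kernel w \o pt) = (2 * pi)%:C.
Proof.
have E0 (z : C) : gauss_kernel 0 z = (expR (- (2^-1 * normc z ^+ 2)))%:C.
  rewrite /gauss_kernel subr0 mulc_conj -cexp_real; congr cexp.
  by rewrite half_complex -rmorphM -rmorphN mulrC.
have int0 : cintegral lam (gauss_kernel 0 \o pt) = (2 * pi)%:C.
  rewrite (eq_cintegral _ (g := fun z => (expR (- (2^-1 * normc (pt z) ^+ 2)))%:C)); last first.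
    by move=> z /=; rewrite E0.
  apply: eqc_ReIm => /=; last by rewrite Rintegral_cst// mul0r.
  by rewrite /Rintegral integral_gauss_plane ?invr_gt0//= invrK mulrC.
pose g z := cexp (conjc w * z / 2).
have ge : entire1 g.
  move=> p; have u1 := has_wirtinger_mul (has_wirtinger_cst (conjc w / 2) p) (has_wirtinger_id p).
  have H := has_wirtinger_comp (has_wirtinger_cexp _) u1.
  apply: (has_wirtinger_ex H) => [z|]; last by ring.
  by rewrite /g /=; congr cexp; ring.
have gE (z : C) : conjc (g z * gauss_kernel 0 z) = gauss_kernel w z.
  rewrite /g /gauss_kernel subr0 -cexpD conj_cexp; congr cexp.
  have cE (h : C) : conjc h = h ->
      conjc (conjc w * z * h + - (z * conjc z * h)) = - ((z - w) * conjc z * h).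
    by move=> hh; rewrite rmorphD rmorphN !rmorphM /= hh !conjcK; ring.
  by apply: cE; rewrite half_complex conjc_real.
have gi : cintegrable lam (fun z => g (pt z) * gauss_kernel 0 (pt z)).
  apply: eq_cintegrable (cintegrable_conj (cintegrable_gauss_kernel w)) => z.
  by rewrite [LHS](_ : _ = conjc (gauss_kernel w (pt z)))// -gE conjcK.
rewrite -(eq_cintegral _ (f := fun z => conjc (g (pt z) * gauss_kernel 0 (pt z)))).
  rewrite cintegral_conj// cintegral_entire_gauss_kernel// int0.
  by rewrite /g mulr0 mul0r cexp0 mul1r conjc_real.
by move=> z; exact: gE.
Qed.

Theorem reproducing_plane (g : C -> C) (w : C) : entire1 g ->
  cintegrable lam (fun z => g (pt z) * gauss_kernel w (pt z)) ->
  cintegral lam (fun z => g (pt z) * gauss_kernel w (pt z)) = (2 * pi)%:C * g w.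
Proof.
move=> ge gi.
by rewrite cintegral_entire_gauss_kernel// cintegral_gauss_kernel mulrC.
Qed.

End gaussian_mean.

(** * Restriction of holomorphic functions to complex lines *)

Section holomorphic_slices.
Variables (R : realType) (n : nat).
Local Notation C := R[i].
Local Notation Cn := 'rV[R[i]]_n.

Lemma complex_normE (x : C) : `|x| = (normc x)%:C. Proof. by []. Qed.

Lemma complex_ge0P (x : C) : 0 <= x -> exists2 a : R, 0 <= a & x = a%:C.
Proof.
by move=> x0; exists (complex.Re x); rewrite -?ler0c RRe_real ?ger0_real.
Qed.

Lemma complex_gt0P (x : C) : 0 < x -> exists2 a : R, 0 < a & x = a%:C.
Proof.
move=> x0; have [a a0 xa] := complex_ge0P (ltW x0).
by exists a => //; move: x0; rewrite xa ltcR.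
Qed.

Lemma holomorphic_line (f : Cn -> C) (z v : Cn) (p : C) : holomorphic f ->
  has_wirtinger (fun a => f (z + a *: v)) p ('d f (z + p *: v) v) 0.
Proof.
move=> hf e e0; set x := z + p *: v.
have [_ /eqaddoP fo] := (diff_locallyP x f).1 (hf x).
have [N N0 vN] := complex_ge0P (normr_ge0 v).
have N1 : 0 < N + 1 by rewrite ltr_wpDl.
have eN : (0 : C) < (e / (N + 1))%:C by rewrite ltcR divr_gt0.
have /nbhs_norm0P[d /complex_gt0P[d' d'0 ->] dP] := fo _ eN.
exists (d' / (N + 1)); first by rewrite divr_gt0.
move=> a ad; have small : `|(a - p) *: v| < d'%:C.
  rewrite normrZ complex_normE vN -rmorphM ltcR.
  move: ad; rewrite ltr_pdivlMr// => ad; apply: le_lt_trans ad.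
  by rewrite ler_wpM2l ?normc_ge0// lerDl.
have := dP _ small.
rewrite [X in `|X|](_ : _ = f ((a - p) *: v + x) - (f x + 'd f x ((a - p) *: v)))//.
rewrite linearZ /= normrZ complex_normE [in leRHS]complex_normE vN.
rewrite -!rmorphM lecR => H; rewrite mul0r addr0.
have -> : z + a *: v = (a - p) *: v + x.
  by rewrite /x scalerBl addrCA subrK.
rewrite opprD addrA in H.
rewrite [X in normc (_ - X)]mulrC; apply: le_trans H _.
rewrite -mulrA [_^-1 * _]mulrC -[in leRHS](mulr1 e) -!mulrA ler_wpM2l ?(ltW e0)//.
rewrite mul1r -[leRHS]mulr1 ler_wpM2l ?normc_ge0//.
by rewrite ler_pdivrMr// mul1r lerDl.
Qed.

Definition continuous_row (f : Cn -> C) : Prop :=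
  forall (z : Cn) (e : R), 0 < e -> exists2 r : R, 0 < r & forall z' : Cn,
    (forall j, normc (z' ord0 j - z ord0 j) < r) -> normc (f z' - f z) <= e.

Lemma holomorphic_continuous_row (f : Cn -> C) : holomorphic f -> continuous_row f.
Proof.
move=> hf z e e0.
have /cvgrPdist_le/(_ e%:C) : f x @[x --> z] --> f z.
  exact: differentiable_continuous (hf z).
rewrite ltcR => /(_ e0)/nbhs_ballP[d /complex_gt0P[d' d'0 ->] dP].
exists d' => // z' z'z; rewrite normc_subC -lecR -complex_normE.
apply: dP; split; first by rewrite ltcR.
move=> i j; rewrite (ord1 i) -ball_normE /= complex_normE normc_subC ltcR.
exact: z'z.
Qed.

Definition subst_coord (z : Cn) (j : 'I_n) (a : C) : Cn :=
  \row_k (if k == j then a else z ord0 k).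

(** Unlike differentiability in all variables together, this is inherited without
    effort when the first variable is fixed, which is what the induction on the
    number of variables uses. *)
Definition sep_holomorphic (f : Cn -> C) : Prop :=
  continuous_row f /\ forall z j, entire1 (fun a => f (subst_coord z j a)).

Lemma holomorphic_sep (f : Cn -> C) : holomorphic f -> sep_holomorphic f.
Proof.
move=> hf; split; first exact: holomorphic_continuous_row.
move=> z j p; have H := holomorphic_line (subst_coord z j 0) (delta_mx ord0 j) p hf.
apply: (has_wirtinger_ex H) => // a; congr f; apply/rowP => k.
rewrite !mxE eqxx /=; case: (k =P j) => _; by rewrite ?mulr1 ?mulr0 ?add0r ?addr0.
Qed.

End holomorphic_slices.

(** * Fubini's theorem for powers of a measure *)

Section power_measure_fubini.
Context d (T : measurableType d) (R : realType).
Variable mu : {sigma_finite_measure set T -> \bar R}.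

Lemma power_measure_sigma_finite n : sigma_finite setT (power_measure mu n).
Proof.
have /sigma_finiteP[B [TB ndB Boo]] := sigma_finiteT mu.
pose F n k : set (n.-tuple T) := [set t | forall i, B k (tnth t i)].
have mF m k : measurable (F m k).
  have -> : F m k = \bigcap_(i in [set: 'I_m]) ((fun t => tnth t i) @^-1` (B k)).
    by apply/seteqP; split => t /= H i; [move=> _|]; exact: H.
  apply: fin_bigcap_measurable => // i _; rewrite -[X in measurable X]setTI.
  by apply: measurable_tnth => //; exact: (Boo k).1.
have ndBk i k x : (i <= k)%N -> B i x -> B k x.
  by move=> ik; move/subsetPset: (ndB _ _ ik); exact.
exists (F n).
  apply/esym/seteqP; split => // t _.
  have /choice[k kP] : forall i, exists k, B k (tnth t i).
    by move=> i; have : [set: T] (tnth t i) by []; rewrite TB => -[k _ ?]; exists k.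
  exists (\max_(i < n) k i)%N => // i; apply: ndBk (kP i).
  exact: (leq_bigmax (F := k)).
move=> k; split; first exact: mF.
elim: n => [|n IH].
  by rewrite /= diracE; case: (_ \in _); rewrite ltry.
have -> : power_measure mu n.+1 (F n.+1 k) =
    (power_measure mu n \x mu)%E (F n k `*` B k).
  rewrite /= /measure_consT /pushforward; congr ((_ \x _)%E _).
  apply/seteqP; split => -[t x] /=.
    move=> H; split; last by have := H ord0; rewrite (tnth_nth x).
    move=> i; have := H (lift ord0 i); rewrite !(tnth_nth x) /=.
    by [].
  move=> [Ht Bx] i; rewrite (tnth_nth x) /=.
  case: (unliftP ord0 i) => [j ->|->] //.
  by have := Ht j; rewrite (tnth_nth x).
rewrite product_measure1E; [|exact: mF|exact: (Boo k).1].
by rewrite lte_mul_pinfty ?ge0_fin_numE//; exact: (Boo k).2.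
Qed.

(** The function [power_measure], as a support for the sigma-finite structure that
    Fubini's theorem requires. *)
Definition sigma_finite_power n : set (n.-tuple T) -> \bar R := power_measure mu n.

HB.instance Definition _ n := Measure.on (@sigma_finite_power n).
HB.instance Definition _ n := Measure_isSigmaFinite.Build _ _ _
  (@sigma_finite_power n) (power_measure_sigma_finite n).

Lemma integral_power_measureS n (h : n.+1.-tuple T -> R) :
  (power_measure mu n.+1).-integrable setT (EFin \o h) ->
  [/\ {ae power_measure mu n, forall t,
        mu.-integrable setT (EFin \o (fun x => h (consT (t, x))))},
    (power_measure mu n).-integrable setT
        (fun t => \int[mu]_x (h (consT (t, x)))%:E)%E &
    (\int[power_measure mu n.+1]_t (h t)%:E =
     \int[power_measure mu n]_t \int[mu]_x (h (consT (t, x)))%:E)%E].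
Proof.
move=> hi; have mh : measurable_fun setT (EFin \o h) by exact: measurable_int hi.
have mc := @measurable_consT _ T n.
have hi' : (@sigma_finite_power n \x mu)%E.-integrable setT (EFin \o h \o @consT _ T n).
  apply/integrableP; split; first exact: measurableT_comp mh mc.
  have /integrableP[_] := hi; apply: le_lt_trans.
  rewrite [leRHS](ge0_integral_pushforward mc)//.
  exact: measurableT_comp.
split.
- exact: (ae_integrable1 hi').
- exact: (integrable_fubini_F hi').
- transitivity (\int[(@sigma_finite_power n \x mu)%E]_z (EFin \o h \o @consT _ T n) z)%E.
    exact: (integral_pushforward mc mh hi').
  exact: esym (integral12_prod_meas1 hi').
Qed.

End power_measure_fubini.

(** * Measurable complex functions *)

Section complex_measurable.
Context d (T : measurableType d) (R : realType).
Implicit Types f g : T -> R[i].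

Definition cmeasurable f : Prop :=
  measurable_fun setT (fun x => complex.Re (f x)) /\
  measurable_fun setT (fun x => complex.Im (f x)).

Lemma eq_cmeasurable f g : f =1 g -> cmeasurable f -> cmeasurable g.
Proof. by move=> /funext ->. Qed.

Lemma cmeasurable_cst (c : R[i]) : cmeasurable (fun=> c).
Proof. by split; exact: measurable_cst. Qed.

Lemma cmeasurable_real (h : T -> R) : measurable_fun setT h ->
  cmeasurable (fun x => (h x)%:C).
Proof. by move=> mh; split => //=; exact: measurable_cst. Qed.

Lemma cmeasurable_add f g : cmeasurable f -> cmeasurable g ->
  cmeasurable (fun x => f x + g x).
Proof.
move=> [f1 f2] [g1 g2]; split.
  by under eq_fun do rewrite Re_add; exact: measurable_funD.
by under eq_fun do rewrite Im_add; exact: measurable_funD.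
Qed.

Lemma cmeasurable_mul f g : cmeasurable f -> cmeasurable g ->
  cmeasurable (fun x => f x * g x).
Proof.
move=> [f1 f2] [g1 g2]; split.
  by under eq_fun do rewrite Re_mul; apply: measurable_funB; exact: measurable_funM.
by under eq_fun do rewrite Im_mul; apply: measurable_funD; exact: measurable_funM.
Qed.

Lemma cmeasurable_conj f : cmeasurable f -> cmeasurable (fun x => conjc (f x)).
Proof.
move=> [f1 f2]; split; first by under eq_fun do rewrite Re_conj.
by under eq_fun do rewrite Im_conj; exact: measurableT_comp.
Qed.

Lemma cmeasurable_sum n (f : 'I_n -> T -> R[i]) : (forall j, cmeasurable (f j)) ->
  cmeasurable (fun x => \sum_(j < n) f j x).
Proof.
move=> mf; elim: n f mf => [|n IH] f mf.
  by apply: eq_cmeasurable (cmeasurable_cst 0) => x; rewrite big_ord0.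
apply: eq_cmeasurable (cmeasurable_add (mf ord0) (IH _ (fun j => mf (lift ord0 j)))).
by move=> x; rewrite big_ord_recl.
Qed.

Lemma cmeasurable_cexp f : cmeasurable f -> cmeasurable (fun x => cexp (f x)).
Proof.
move=> [f1 f2].
have ms : measurable_fun [set: R] (@sin R).
  by apply: continuous_measurable_fun; exact: continuous_sin.
have mc : measurable_fun [set: R] (@cos R).
  by apply: continuous_measurable_fun; exact: continuous_cos.
have me : measurable_fun setT (fun x => expR (complex.Re (f x))).
  exact: measurableT_comp.
split; rewrite /cexp/=; apply: measurable_funM => //.
  exact: (measurableT_comp mc f2).
exact: (measurableT_comp ms f2).
Qed.

End complex_measurable.

(** * The reproducing formula in several variables *)

Section reproducing.
Variable R : realType.
Local Notation C := R[i].
Notation plane := (measurableTypeR R * measurableTypeR R)%type.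
Notation lam := (lebesgue_plane R).

Definition cons_row n (a : C) (z : 'rV[C]_n) : 'rV[C]_n.+1 :=
  \row_k oapp (fun j => z ord0 j) a (unlift ord0 k).

Lemma cons_row0 n a (z : 'rV[C]_n) : cons_row a z ord0 ord0 = a.
Proof. by rewrite mxE unlift_none. Qed.

Lemma cons_rowS n a (z : 'rV[C]_n) j : cons_row a z ord0 (lift ord0 j) = z ord0 j.
Proof. by rewrite mxE liftK. Qed.

Lemma row_cons n (w : 'rV[C]_n.+1) :
  w = cons_row (w ord0 ord0) (\row_j w ord0 (lift ord0 j)).
Proof.
apply/rowP => k; case: (unliftP ord0 k) => [j ->|->]; last by rewrite cons_row0.
by rewrite cons_rowS mxE.
Qed.

Lemma complex_point_cons n (t : n.-tuple plane) (p : plane) :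
  complex_point (consT (t, p)) = cons_row (plane_point p) (complex_point t).
Proof.
apply/rowP => k; case: (unliftP ord0 k) => [j ->|->].
  by rewrite cons_rowS !mxE !(tnth_nth p).
by rewrite cons_row0 mxE.
Qed.

Definition gauss_kernel_row n (w z : 'rV[C]_n) : C :=
  cexp (- (\sum_(j < n) (z ord0 j - w ord0 j) * conjc (z ord0 j)) / 2).

Lemma gauss_kernel_cons n a b (w z : 'rV[C]_n) :
  gauss_kernel_row (cons_row a w) (cons_row b z) =
  gauss_kernel a b * gauss_kernel_row w z.
Proof.
rewrite /gauss_kernel_row /gauss_kernel -cexpD big_ord_recl !cons_row0.
under eq_bigr do rewrite !cons_rowS.
by congr cexp; ring.
Qed.

Lemma cexp_neq0 (z : C) : cexp z != 0.
Proof. by rewrite -normc_gt0 normc_cexp expR_gt0. Qed.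

Lemma cmeasurable_coord n (j : 'I_n) :
  cmeasurable (fun t : n.-tuple plane => complex_point t ord0 j).
Proof.
have mj : measurable_fun setT (fun t : n.-tuple plane => tnth t j).
  exact: measurable_tnth.
split; under eq_fun do rewrite mxE/=.
  exact: (measurableT_comp measurable_fst mj).
exact: (measurableT_comp measurable_snd mj).
Qed.

Lemma cmeasurable_gauss_kernel n (w : 'rV[C]_n) :
  cmeasurable (fun t => gauss_kernel_row w (complex_point t)).
Proof.
apply: cmeasurable_cexp.
have ms := cmeasurable_sum (fun j : 'I_n => cmeasurable_mul
  (cmeasurable_add (cmeasurable_coord j) (cmeasurable_cst _ (- w ord0 j)))
  (cmeasurable_conj (cmeasurable_coord j))).
apply: eq_cmeasurable (cmeasurable_mul (cmeasurable_cst _ (- 2^-1)) ms) => t.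
by ring.
Qed.

Lemma cmeasurable_continuous_row n (f : 'rV[C]_n -> C) : continuous_row f ->
  cmeasurable (fun t => f (complex_point t)).
Proof.
move=> cf.
have H (g : C -> R) : (forall x y, `|g x - g y| <= normc (x - y)) ->
    measurable_fun setT (fun t => g (f (complex_point t))).
  move=> gl; apply: measurable_continuous_tuple => t e e0.
  have [r r0 fr] := cf (complex_point t) e e0.
  exists (r / 2) => [|t' tt']; first by rewrite divr_gt0.
  apply: le_trans (gl _ _) _; apply: fr => j; rewrite !mxE.
  apply: le_lt_trans (normc_le_ReIm _) _; rewrite !ReImE/=.
  by have [] := tt' j; lra.
split; apply: H => x y.
  by rewrite -Re_opp -Re_add Re_le_normc.
by rewrite -Im_opp -Im_add Im_le_normc.
Qed.

Lemma sep_holomorphic_cons n (f : 'rV[C]_n.+1 -> C) (a : C) :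
  sep_holomorphic f -> sep_holomorphic (fun z => f (cons_row a z)).
Proof.
move=> [cf sf]; split.
  move=> z e e0; have [r r0 fr] := cf (cons_row a z) e e0.
  exists r => // z' zz'; apply: fr => k; case: (unliftP ord0 k) => [j ->|->].
    by rewrite !cons_rowS.
  by rewrite !cons_row0 subrr normc0.
move=> z j p; have [A HA] := sf (cons_row a z) (lift ord0 j) p.
exists A; apply: eq_has_wirtinger HA; exists 1 => // b _; congr f.
apply/rowP => k; rewrite mxE; case: (unliftP ord0 k) => [i ->|->].
  by rewrite !cons_rowS mxE (inj_eq lift_inj).
by rewrite !cons_row0.
Qed.

Lemma entire1_cons n (f : 'rV[C]_n.+1 -> C) (z : 'rV[C]_n) :
  sep_holomorphic f -> entire1 (fun a => f (cons_row a z)).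
Proof.
move=> [_ sf] p; have [A HA] := sf (cons_row 0 z) ord0 p.
exists A; apply: eq_has_wirtinger HA; exists 1 => // b _; congr f.
apply/rowP => k; rewrite mxE; case: (unliftP ord0 k) => [i ->|->].
  by rewrite !cons_rowS.
by rewrite !cons_row0.
Qed.

Lemma eq_ae_integrable d (T : measurableType d) (m : {measure set T -> \bar R})
  (f g : T -> \bar R) : measurable_fun setT g -> {ae m, forall x, f x = g x} ->
  m.-integrable setT f -> m.-integrable setT g.
Proof.
move=> mg fg /integrableP[mf fi]; apply/integrableP; split => //.
rewrite (ae_eq_integral (abse \o f) (abse \o g))//.
- exact: measurableT_comp.
- exact: measurableT_comp.
- by apply: filterS fg => x /= ->.
Qed.

(** For almost every value of the other variables, the one-variable formula
    evaluates the integral over the first one; the induction hypothesis applies to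
    the function of the other variables obtained by fixing the first at its value
    in w. *)
Theorem reproducing_row n (f : 'rV[C]_n -> C) (w : 'rV[C]_n) : sep_holomorphic f ->
  cintegrable (volume R n) (fun t => f (complex_point t) * gauss_kernel_row w (complex_point t)) ->
  cintegral (volume R n) (fun t => f (complex_point t) * gauss_kernel_row w (complex_point t)) =
  ((2 * pi) ^+ n)%:C * f w.
Proof.
elim: n f w => [|n IH] f w hf fi.
  have E t : complex_point t = w by apply/rowP => -[].
  rewrite expr0 mul1r (eq_cintegral _ (g := fun=> f w)); last first.
    move=> t; rewrite E /gauss_kernel_row big_ord0 oppr0 mul0r cexp0 mulr1//.
  apply: eqc_ReIm => /=.
    by rewrite /Rintegral integral_dirac// diracE mem_set// mul1e.
  by rewrite /Rintegral integral_dirac// diracE mem_set// mul1e.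
rewrite (row_cons w) in fi *; set a := w ord0 ord0 in fi *.
set w' := \row_j _ in fi *.
pose g z := f (cons_row a z).
have hg : sep_holomorphic g by exact: sep_holomorphic_cons.
pose Psi t := g (complex_point t) * gauss_kernel_row w' (complex_point t).
have mPsi : cmeasurable Psi.
  apply: cmeasurable_mul; first exact: cmeasurable_continuous_row hg.1.
  exact: cmeasurable_gauss_kernel.
have [fiR fiI] := fi.
have [aeR iR EqR] := integral_power_measureS fiR.
have [aeI iI EqI] := integral_power_measureS fiI.
have pRe x : complex.Re ((2 * pi)%:C * x : C) = 2 * pi * complex.Re x.
  by rewrite Re_mul/= mul0r subr0.
have pIm x : complex.Im ((2 * pi)%:C * x : C) = 2 * pi * complex.Im x.
  by rewrite Im_mul/= mul0r addr0.
have aeE : {ae volume R n, forall t,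
    (\int[lam]_p (complex.Re (f (complex_point (consT (t, p))) *
       gauss_kernel_row (cons_row a w') (complex_point (consT (t, p)))))%:E =
      (2 * pi * complex.Re (Psi t))%:E)%E /\
    (\int[lam]_p (complex.Im (f (complex_point (consT (t, p))) *
       gauss_kernel_row (cons_row a w') (complex_point (consT (t, p)))))%:E =
      (2 * pi * complex.Im (Psi t))%:E)%E}.
  apply: filterS2 aeR aeI => t iRt iIt.
  set k := gauss_kernel_row w' (complex_point t).
  have E p : f (complex_point (consT (t, p))) *
       gauss_kernel_row (cons_row a w') (complex_point (consT (t, p))) =
       k * (f (cons_row (plane_point p) (complex_point t)) * gauss_kernel a (plane_point p)).
    by rewrite complex_point_cons gauss_kernel_cons /k; ring.
  have it : cintegrable lam (fun p => f (complex_point (consT (t, p))) *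
       gauss_kernel_row (cons_row a w') (complex_point (consT (t, p)))) by [].
  have it' : cintegrable lam (fun p => f (cons_row (plane_point p) (complex_point t)) *
      gauss_kernel a (plane_point p)).
    apply: eq_cintegrable (cintegrable_scale k^-1 it) => p.
    by rewrite E mulKf// cexp_neq0.
  have he := entire1_cons (complex_point t) hf.
  have EqT : cintegral lam (fun p => f (complex_point (consT (t, p))) *
       gauss_kernel_row (cons_row a w') (complex_point (consT (t, p)))) =
       (2 * pi)%:C * Psi t.
    rewrite (eq_cintegral _ E) cintegral_scale// [X in _ * X](reproducing_plane he it') /Psi /g -/k.
    by ring.
  split.
    rewrite -pRe -EqT /= /Rintegral fineK//.
    exact: (integrable_fin_num measurableT iRt).
  rewrite -pIm -EqT /= /Rintegral fineK//.
  exact: (integrable_fin_num measurableT iIt).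
have pi2 : 2 * pi != 0 :> R by rewrite mulf_neq0// gt_eqF// pi_gt0.
have aeR' : {ae volume R n, forall t,
    (\int[lam]_p (complex.Re (f (complex_point (consT (t, p))) *
       gauss_kernel_row (cons_row a w') (complex_point (consT (t, p)))))%:E =
      (2 * pi * complex.Re (Psi t))%:E)%E} by apply: filterS aeE => t [].
have aeI' : {ae volume R n, forall t,
    (\int[lam]_p (complex.Im (f (complex_point (consT (t, p))) *
       gauss_kernel_row (cons_row a w') (complex_point (consT (t, p)))))%:E =
      (2 * pi * complex.Im (Psi t))%:E)%E} by apply: filterS aeE => t [].
have mR : measurable_fun setT (fun t => (2 * pi * complex.Re (Psi t))%:E).
  apply/measurable_EFinP; apply: measurable_funM; [exact: measurable_cst|exact: mPsi.1].
have mI : measurable_fun setT (fun t => (2 * pi * complex.Im (Psi t))%:E).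
  apply/measurable_EFinP; apply: measurable_funM; [exact: measurable_cst|exact: mPsi.2].
have iPsi : cintegrable (volume R n) Psi.
  split.
    have := integrable_scaleR (2 * pi)^-1 measurableT (eq_ae_integrable mR aeR' iR).
    by apply: eq_integrable => // t _ /=; rewrite mulKf.
  have := integrable_scaleR (2 * pi)^-1 measurableT (eq_ae_integrable mI aeI' iI).
  by apply: eq_integrable => // t _ /=; rewrite mulKf.
rewrite exprS rmorphM -mulrA -[f _]/(g w') -IH// -/Psi -cintegral_scale//.
rewrite /cintegral; congr (_ +i* _); rewrite /Rintegral.
  rewrite [X in fine X]EqR; congr fine.
  transitivity (\int[volume R n]_t (2 * pi * complex.Re (Psi t))%:E)%E.
    apply: ae_eq_integral => //; first exact: measurable_int iR.
    by apply: filterS aeR' => t + _.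
  by apply: eq_integral => t _; rewrite -pRe.
rewrite [X in fine X]EqI; congr fine.
transitivity (\int[volume R n]_t (2 * pi * complex.Im (Psi t))%:E)%E.
  apply: ae_eq_integral => //; first exact: measurable_int iI.
  by apply: filterS aeI' => t + _.
by apply: eq_integral => t _; rewrite -pIm.
Qed.

End reproducing.

(** * The reproducing kernels *)

Section fock_kernel.
Variables (R : realType) (n : nat).
Local Notation C := R[i].
Local Notation Cn := 'rV[R[i]]_n.
Implicit Types (z w : Cn).

Lemma differentiable_cexp (x : C) : differentiable (@cexp R : C -> C) x.
Proof.
apply/derivable1_diffP; apply/cvg_ex; exists (cexp x).
apply/cvgrPdist_le => e /complex_gt0P[e' e'0 ->].
have [r r0 H] := has_wirtinger_cexp x e'0.
have r0' : (0 : C) < r%:C by rewrite ltcR.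
apply/nbhs_normP; exists r%:C => // h; rewrite /ball_ /= sub0r normrN complex_normE ltcR => hr h0.
have hn : 0 < normc h by rewrite normc_gt0.
have := H (h + x); rewrite addrK => /(_ hr); rewrite mul0r addr0 => Hh.
rewrite complex_normE lecR -(ler_pM2r hn) -normcM; apply: le_trans Hh.
rewrite -normc_opp /GRing.scale /= mulr1 mulrBl opprB mulrAC mulVf// mul1r.
by rewrite [cexp x * h]mulrC.
Qed.

Definition cinner z w : C := \sum_(j < n) z ord0 j * conjc (w ord0 j).

Definition fock_kernel w z : C := cexp (cinner z w / 2).

Lemma holomorphic_fock_kernel w : holomorphic (fock_kernel w).
Proof.
move=> z.
have -> : fock_kernel w = @cexp R \o
   (\sum_(j < n) ((conjc (w ord0 j) / 2) \*: (fun z : Cn => z ord0 j : C))).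
  apply/funext => x; rewrite /fock_kernel /=; congr cexp.
  rewrite /cinner mulr_suml fct_sumE; apply: eq_bigr => j _.
  rewrite /= /GRing.scale /=; ring.
apply: differentiable_comp; last exact: differentiable_cexp.
apply: differentiable_sum => j; apply: differentiableZ.
exact: differentiable_coord.
Qed.

End fock_kernel.

(** * Integrability against the Gaussian weight *)

Section fock_integrals.
Variables (R : realType) (n : nat).
Local Notation C := R[i].
Local Notation Cn := 'rV[R[i]]_n.
Notation plane := (measurableTypeR R * measurableTypeR R)%type.
Notation vol := (volume R n).
Notation cp := (@complex_point R n).
Implicit Types (z w : Cn).

Lemma conjcM (x y : C) : conjc (x * y) = conjc x * conjc y.
Proof. exact: rmorphM. Qed.

Lemma conj_half : conjc (2^-1 : C) = 2^-1.
Proof. by rewrite half_complex conjc_real. Qed.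

Lemma csqnorm_cinner z : cinner z z = (csqnorm z)%:C.
Proof. by rewrite /cinner /csqnorm rmorph_sum; apply: eq_bigr => j _; rewrite mulc_conj. Qed.

Lemma conj_cinner z w : conjc (cinner z w) = cinner w z.
Proof.
rewrite /cinner rmorph_sum; apply: eq_bigr => j _.
by rewrite rmorphM /= conjcK mulrC.
Qed.

Lemma conj_fock_kernel z w : conjc (fock_kernel z w) = fock_kernel w z.
Proof.
rewrite /fock_kernel conj_cexp; congr cexp.
by rewrite conjcM conj_half conj_cinner.
Qed.

Lemma fock_kernel0 z : fock_kernel 0 z = 1.
Proof.
rewrite /fock_kernel /cinner big1 ?mul0r ?cexp0// => j _.
by rewrite mxE conjc0 mulr0.
Qed.

Lemma gauss_kernel_rowE w z :
  gauss_kernel_row w z = conjc (fock_kernel w z) * (gaussian z)%:C.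
Proof.
rewrite conj_fock_kernel /gaussian -cexp_real /fock_kernel -cexpD; congr cexp.
have -> : (- (csqnorm z / 2))%:C = - (cinner z z / 2).
  by rewrite rmorphN rmorphM csqnorm_cinner half_complex.
have -> : \sum_(j < n) (z ord0 j - w ord0 j) * conjc (z ord0 j) =
    cinner z z - cinner w z by rewrite -sumrB; apply: eq_bigr => j _; rewrite mulrBl.
by ring.
Qed.

(** The kernels are compared with this norm because it is a sum over coordinates,
    as is the squared norm in the Gaussian weight. *)
Definition norm1 z : R := \sum_(j < n) normc (z ord0 j).

Lemma norm1_ge0 z : 0 <= norm1 z.
Proof. by apply: sumr_ge0 => j _; exact: normc_ge0. Qed.

Lemma normc_coord_le z j : normc (z ord0 j) <= norm1 z.
Proof.
rewrite /norm1 (bigD1 j)//= lerDl; apply: sumr_ge0 => i _; exact: normc_ge0.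
Qed.

Lemma normc_sum_le (I : Type) (s : seq I) (f : I -> C) :
  normc (\sum_(i <- s) f i) <= \sum_(i <- s) normc (f i).
Proof.
elim: s => [|i s IH]; first by rewrite !big_nil normc0.
by rewrite !big_cons; apply: le_trans (normc_addle _ _) _; rewrite lerD2l.
Qed.

Lemma normc_cinner_le z w : normc (cinner z w) <= norm1 w * norm1 z.
Proof.
apply: le_trans (normc_sum_le _ _) _; rewrite {2}/norm1 mulr_sumr.
apply: ler_sum => j _; rewrite normcM normc_conj mulrC ler_wpM2r ?normc_ge0//.
exact: normc_coord_le.
Qed.

Lemma csqnorm_le_norm1 z : csqnorm z <= norm1 z ^+ 2.
Proof.
rewrite expr2 {1}/norm1 mulr_suml; apply: ler_sum => j _.
by rewrite expr2 ler_wpM2l ?normc_ge0// normc_coord_le.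
Qed.

(** Coordinate by coordinate, b |z_j| is at most b^2 + |z_j|^2 / 4. Half of the
    Gaussian weight absorbs the exponential, the other half remains integrable. *)
Lemma expR_norm1_gaussian (b : R) z :
  expR (b * norm1 z) * gaussian z <=
  expR (b ^+ 2 *+ n) * expR (- (4^-1 * csqnorm z)).
Proof.
rewrite /gaussian -!expRD ler_expR.
have : b * norm1 z <= b ^+ 2 *+ n + 4^-1 * csqnorm z.
  rewrite /norm1 /csqnorm !mulr_sumr -[X in X *+ n](mul1r) -[n in _ *+ n]card_ord.
  rewrite mul1r -sumr_const -big_split /=; apply: ler_sum => j _.
  rewrite -subr_ge0 [X in 0 <= X](_ : _ = (b - normc (z ord0 j) / 2) ^+ 2) ?sqr_ge0//.
  by field.
lra.
Qed.

End fock_integrals.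

Section gauss_integrable.
Variable R : realType.
Notation plane := (measurableTypeR R * measurableTypeR R)%type.

Lemma csqnorm_cons n a (z : 'rV[R[i]]_n) :
  csqnorm (cons_row a z) = normc a ^+ 2 + csqnorm z.
Proof.
rewrite /csqnorm big_ord_recl cons_row0; congr (_ + _).
by apply: eq_bigr => j _; rewrite cons_rowS.
Qed.

Lemma measurable_csqnorm n (a : R) : measurable_fun setT
  (fun t : n.-tuple plane => expR (- (a * csqnorm (complex_point t)))).
Proof.
have [m _] : cmeasurable (fun t : n.-tuple plane =>
    cinner (complex_point t) (complex_point t)).
  apply: cmeasurable_sum => j; apply: cmeasurable_mul; first exact: cmeasurable_coord.
  by apply: cmeasurable_conj; exact: cmeasurable_coord.
have m' : measurable_fun setT (fun t : n.-tuple plane => csqnorm (complex_point t)).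
  by under eq_fun do rewrite -[csqnorm _]/(complex.Re (csqnorm _)%:C) -csqnorm_cinner.
apply: measurableT_comp => //; apply: measurableT_comp => //.
exact: measurable_funM.
Qed.

Lemma integral_gauss_volume n (a : R) : 0 < a ->
  (\int[volume R n]_t (expR (- (a * csqnorm (complex_point t))))%:E < +oo)%E.
Proof.
move=> a0; elim: n => [|n IH].
  have E : (fun t : 0.-tuple plane => (expR (- (a * csqnorm (complex_point t))))%:E) = cst 1%:E.
    apply/funext => t; rewrite /csqnorm big_ord0 mulr0 oppr0 expR0//.
  by rewrite E integral_cst// mul1e /= diracT ltry.
have mh := @measurable_csqnorm n.+1 a.
pose h (t : n.+1.-tuple plane) := (expR (- (a * csqnorm (complex_point t))))%:E.
have mhE : measurable_fun setT h by apply/measurable_EFinP.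
have h0 t : (0 <= h t)%E by rewrite lee_fin expR_ge0.
have mc := @measurable_consT _ plane n.
have -> : (\int[volume R n.+1]_t h t)%E =
   (\int[(@sigma_finite_power _ _ _ (lebesgue_plane R) n \x lebesgue_plane R)%E]_z
      (h \o @consT _ plane n) z)%E.
  by rewrite [LHS](ge0_integral_pushforward mc).
rewrite fubini_tonelli1; last 2 first.
- exact: measurableT_comp mhE mc.
- by move=> z; exact: h0.
have -> : fubini_F (lebesgue_plane R) (h \o @consT _ plane n) =
   (fun t => (pi / a)%:E * (expR (- (a * csqnorm (complex_point t))))%:E)%E.
  apply/funext => t; rewrite /fubini_F /h /=.
  under eq_integral do rewrite complex_point_cons csqnorm_cons mulrDr opprD expRD EFinM.
  rewrite ge0_integralZr//.
  - by rewrite integral_gauss_plane.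
  - exact: (measurable_int _ (integrable_gauss_plane a0)).
rewrite ge0_integralZl//.
- by apply: lte_mul_pinfty; rewrite ?lee_fin ?divr_ge0 ?pi_ge0// ltW.
- by apply/measurable_EFinP; exact: measurable_csqnorm.
- by rewrite lee_fin divr_ge0 ?pi_ge0// ltW.
Qed.

Lemma integrable_gauss_volume n (a : R) : 0 < a -> (volume R n).-integrable setT
  (EFin \o (fun t => expR (- (a * csqnorm (complex_point t))))).
Proof.
move=> a0; apply/integrableP; split.
  by apply/measurable_EFinP; exact: measurable_csqnorm.
under eq_integral do rewrite /= ger0_norm ?expR_ge0//.
exact: integral_gauss_volume.
Qed.

End gauss_integrable.

(** * Inner products and norms in the Fock space *)

Section fock_space.
Variables (R : realType) (n : nat).
Local Notation C := R[i].
Local Notation Cn := 'rV[R[i]]_n.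
Notation plane := (measurableTypeR R * measurableTypeR R)%type.
Notation vol := (volume R n).
Notation cp := (@complex_point R n).
Implicit Types (z w : Cn) (f g : Cn -> C).

Lemma gaussian_ge0 z : 0 <= gaussian z. Proof. exact: expR_ge0. Qed.

Lemma measurable_gaussian :
  measurable_fun setT (fun t : n.-tuple plane => gaussian (cp t)).
Proof.
by under eq_fun do rewrite /gaussian mulrC; exact: measurable_csqnorm.
Qed.

Lemma cintegrable_exp_type (F : n.-tuple plane -> C) (b K : R) : cmeasurable F ->
  0 <= K ->
  (forall t, normc (F t) <= K * (expR (b * norm1 (cp t)) * gaussian (cp t))) ->
  cintegrable vol F.
Proof.
move=> [m1 m2] K0 FK.
apply: (le_cintegrable m1 m2 (h := fun t => K * expR (b ^+ 2 *+ n) *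
  expR (- (4^-1 * csqnorm (cp t))))).
  move=> t; apply: le_trans (FK t) _; rewrite -mulrA ler_wpM2l//.
  exact: expR_norm1_gaussian.
apply: integrable_scaleR => //; apply: integrable_gauss_volume.
by rewrite invr_gt0.
Qed.

Lemma fock_const_gt0 : 0 < fock_const R n.
Proof. by rewrite exprn_gt0// invr_gt0 mulr_gt0// pi_gt0. Qed.

Lemma measurable_fock_weight f : continuous_row f ->
  measurable_fun setT (fun t => normc (f (cp t)) ^+ 2 * gaussian (cp t)).
Proof.
move=> /cmeasurable_continuous_row[m1 m2].
apply: measurable_funM; last exact: measurable_gaussian.
under eq_fun do rewrite sqr_normc.
by apply: measurable_funD; exact: measurable_funX.
Qed.

Lemma fock_integrable f : fock f ->
  vol.-integrable setT (EFin \o (fun t => normc (f (cp t)) ^+ 2 * gaussian (cp t))).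
Proof.
move=> [hf nf]; apply/integrableP; split.
  apply/measurable_EFinP.
  exact: measurable_fock_weight (holomorphic_continuous_row hf).
have w0 t : 0 <= normc (f (cp t)) ^+ 2 * gaussian (cp t).
  by rewrite mulr_ge0 ?sqr_ge0 ?gaussian_ge0.
under eq_integral do rewrite /= (ger0_norm (w0 _)).
move: nf; rewrite /fock_esqnorm.
set I := (\int[_]_t _)%E; have [->|] := eqVneq I +oo%E.
  by rewrite gt0_muley ?lte_fin ?fock_const_gt0.
by rewrite -ltey.
Qed.

Lemma fock_dot_cintegrable f g : fock f -> fock g ->
  cintegrable vol (fun t => f (cp t) * conjc (g (cp t)) * (gaussian (cp t))%:C).
Proof.
move=> ff fg; have fi := fock_integrable ff; have gi := fock_integrable fg.
have [m1 m2] : cmeasurable (fun t => f (cp t) * conjc (g (cp t)) * (gaussian (cp t))%:C).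
  apply: cmeasurable_mul; last first.
    exact: cmeasurable_real measurable_gaussian.
  apply: cmeasurable_mul.
    exact: cmeasurable_continuous_row (holomorphic_continuous_row ff.1).
  apply: cmeasurable_conj.
  exact: cmeasurable_continuous_row (holomorphic_continuous_row fg.1).
apply: (le_cintegrable m1 m2 _ (integrable_addR measurableT fi gi)) => t.
rewrite -mulrDl normcM [normc _%:C]normc_real (ger0_norm (gaussian_ge0 _)).
rewrite ler_wpM2r ?gaussian_ge0// normcM normc_conj.
set a := normc (f _); set b := normc (g _).
have a0 : 0 <= a by exact: normc_ge0.
have b0 : 0 <= b by exact: normc_ge0.
have ab := mulr_ge0 a0 b0; have := sqr_ge0 (a - b); nra.
Qed.

Lemma fock_dotE f g : fock_dot f g = (fock_const R n)%:C *
  cintegral vol (fun t => f (cp t) * conjc (g (cp t)) * (gaussian (cp t))%:C).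
Proof.
rewrite /fock_dot /cintegral; apply: eqc_ReIm; rewrite !ReImE.
  rewrite /= mul0r subr0; congr (_ * _); apply: eq_Rintegral => t _.
  by rewrite [RHS]Re_mul/= mulr0 subr0.
rewrite /= mul0r addr0; congr (_ * _); apply: eq_Rintegral => t _.
by rewrite [RHS]Im_mul/= mulr0 add0r.
Qed.

Lemma fock_dot_conj f g : fock f -> fock g -> fock_dot g f = conjc (fock_dot f g).
Proof.
move=> ff fg; rewrite !fock_dotE conjcM conjc_real; congr (_ * _).
rewrite -cintegral_conj; last exact: fock_dot_cintegrable.
apply: eq_cintegral => t; rewrite !conjcM conjcK conjc_real; ring.
Qed.

Lemma fock_normE f : fock f -> fock_norm f = Num.sqrt (complex.Re (fock_dot f f)).
Proof.
move=> ff; rewrite /fock_norm; congr Num.sqrt; rewrite /fock_esqnorm fineM//=.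
  congr (_ * _); rewrite /Rintegral; congr fine; apply: eq_integral => t _.
  by rewrite mulc_conj.
exact: (integrable_fin_num measurableT (fock_integrable ff)).
Qed.

Lemma fock_kernel_fock w : fock (fock_kernel w).
Proof.
have hk := @holomorphic_fock_kernel R n w; split => //.
rewrite /fock_esqnorm lte_mul_pinfty ?lee_fin ?(ltW fock_const_gt0)//.
have mk : cmeasurable (fun t => (normc (fock_kernel w (cp t)) ^+ 2 * gaussian (cp t))%:C).
  exact: cmeasurable_real (measurable_fock_weight (holomorphic_continuous_row hk)).
have [] : cintegrable vol (fun t => (normc (fock_kernel w (cp t)) ^+ 2 * gaussian (cp t))%:C).
  apply: (@cintegrable_exp_type _ (norm1 w) 1) => //.
  move=> t; rewrite normc_real normrM (ger0_norm (gaussian_ge0 _)) mul1r.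
  rewrite ler_wpM2r ?gaussian_ge0// ger0_norm ?sqr_ge0//.
  rewrite /fock_kernel normc_cexp -expRM_natl ler_expR.
  rewrite half_complex Re_mul/= mulr0 subr0 mulrCA divff ?mulr1//.
  apply: le_trans (ler_norm _) _; apply: le_trans (Re_le_normc _) _.
  exact: normc_cinner_le.
move=> /integrableP[_ H] _; apply: le_lt_trans H; apply: ge0_le_integral => //=.
- by move=> t _; rewrite lee_fin mulr_ge0 ?sqr_ge0 ?gaussian_ge0.
- by apply/measurable_EFinP; exact: mk.1.
- by apply/measurable_EFinP; apply: measurableT_comp => //; exact: mk.1.
- by move=> t _; rewrite lee_fin ler_norm.
Qed.

(** The conjugate of the kernel times the Gaussian weight is the kernel of
    [reproducing_row], and f times it is integrable since both functions are
    square integrable. *)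
Lemma fock_reproducing f w : fock f -> fock_dot f (fock_kernel w) = f w.
Proof.
move=> ff; have fi := fock_dot_cintegrable ff (fock_kernel_fock w).
have E t : f (cp t) * conjc (fock_kernel w (cp t)) * (gaussian (cp t))%:C =
  f (cp t) * gauss_kernel_row w (cp t) by rewrite gauss_kernel_rowE mulrA.
rewrite fock_dotE (eq_cintegral _ E) reproducing_row; last 2 first.
- exact: holomorphic_sep ff.1.
- exact: eq_cintegrable E fi.
rewrite mulrA -rmorphM /fock_const -exprMn mulVf ?expr1n ?mul1r//.
by rewrite mulf_neq0// gt_eqF// pi_gt0.
Qed.

Lemma fock_norm_kernel w : fock_norm (fock_kernel w) = expR (csqnorm w / 4).
Proof.
rewrite fock_normE ?fock_reproducing; try exact: fock_kernel_fock.
rewrite /fock_kernel csqnorm_cinner half_complex -rmorphM cexp_real /=.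
have -> : csqnorm w / 2 = csqnorm w / 4 *+ 2 by rewrite -mulr_natr; field.
by rewrite mulr2n expRD -expr2 sqrtr_sqr ger0_norm// expR_ge0.
Qed.

End fock_space.

(** * A Liouville theorem *)

Section liouville.
Variables (R : realType) (n : nat).
Local Notation C := R[i].
Local Notation Cn := 'rV[R[i]]_n.
Notation plane := (measurableTypeR R * measurableTypeR R)%type.
Notation vol := (volume R n).
Notation cp := (@complex_point R n).
Implicit Types (z w : Cn).

Lemma cinner_scaler (r : R) z w : cinner z (r%:C *: w) = r%:C * cinner z w.
Proof.
rewrite /cinner mulr_sumr; apply: eq_bigr => j _.
by rewrite mxE conjcM conjc_real mulrCA.
Qed.

Lemma norm1_scaler (r : R) w : norm1 (r%:C *: w) = `|r| * norm1 w.
Proof.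
by rewrite /norm1 mulr_sumr; apply: eq_bigr => j _; rewrite mxE normcM normc_real.
Qed.

Lemma normc_fock_kernel_le w z : normc (fock_kernel w z) <= expR (norm1 w * norm1 z).
Proof.
rewrite /fock_kernel normc_cexp ler_expR; apply: le_trans (ler_norm _) _.
apply: le_trans (Re_le_normc _) _; rewrite normcM half_complex normc_real.
rewrite ger0_norm ?invr_ge0//.
have := normc_cinner_le z w; have := normc_ge0 (cinner z w); lra.
Qed.

Lemma le_expR (x : R) : x <= expR x.
Proof. by have := expR_ge1Dx x; lra. Qed.

Variables (g : Cn -> C) (K : R).
Hypothesis g_hol : holomorphic g.
Hypothesis K0 : 0 <= K.
Hypothesis g_growth : forall z, normc (g z) ^+ 2 <= csqnorm z + K.
Hypothesis g0 : g 0 = 0.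

Let L : R := 1 + Num.sqrt K.

Let L1 : 1 <= L. Proof. by rewrite /L lerDl sqrtr_ge0. Qed.
Let L0 : 0 <= L. Proof. exact: le_trans ler01 L1. Qed.

Lemma growth_linear (r : R) z : 1 <= r ->
  normc (g (r%:C *: z)) <= r * L * expR (norm1 z).
Proof.
move=> r1; have r0 : 0 <= r by lra.
have n0 := norm1_ge0 z; have s0 := sqrtr_ge0 K.
apply: (@le_trans _ _ (r * norm1 z + Num.sqrt K)).
  rewrite -(ler_pXn2r (n := 2))// ?nnegrE ?normc_ge0// ?addr_ge0 ?mulr_ge0//.
  apply: le_trans (g_growth _) _.
  rewrite sqrrD sqr_sqrtr// -addrA [_ *+ 2 + _]addrC addrA -addrA.
  have : csqnorm (r%:C *: z) <= (r * norm1 z) ^+ 2.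
    by apply: le_trans (csqnorm_le_norm1 _) _; rewrite norm1_scaler ger0_norm.
  have : 0 <= (r * norm1 z * Num.sqrt K) *+ 2 by rewrite mulrn_wge0// mulr_ge0// mulr_ge0.
  lra.
have e1 : 1 <= expR (norm1 z) by rewrite -expR0 ler_expR.
have e2 := le_expR (norm1 z).
have H1 : r * norm1 z <= r * expR (norm1 z) by rewrite ler_wpM2l.
have H2 : Num.sqrt K <= r * (Num.sqrt K * expR (norm1 z)).
  rewrite -[leLHS]mul1r ler_pM// -[leLHS]mulr1 ler_wpM2l//.
rewrite /L; lra.
Qed.

(** The kernel at 2w is the square of the kernel at w, so the second difference of
    the kernels at 2w, w and 0 is a perfect square. *)
Lemma kernel_double (w z : Cn) :
  gauss_kernel_row ((2 : R)%:C *: w) z - 2 * gauss_kernel_row w z +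
    gauss_kernel_row 0 z = conjc ((fock_kernel w z - 1) ^+ 2) * (gaussian z)%:C.
Proof.
rewrite !gauss_kernel_rowE fock_kernel0 conjc1.
have -> : fock_kernel (2%:C *: w) z = fock_kernel w z * fock_kernel w z.
  rewrite /fock_kernel cinner_scaler -cexpD; congr cexp; rewrite -mulrDr.
  have -> : (2 : R)%:C = 2 :> C by rewrite rmorph_nat.
  by field.
have cB (x : C) : conjc (x - 1) = conjc x - 1 by rewrite rmorphB rmorph1.
rewrite expr2 !conjcM cB.
ring.
Qed.

Lemma normc_kernel_double (w z : Cn) (r : R) : 1 <= r ->
  normc ((fock_kernel (r^-1%:C *: w) z - 1) ^+ 2) <=
  9 * norm1 w ^+ 2 / r ^+ 2 * expR ((2 + 2 * norm1 w) * norm1 z).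
Proof.
move=> r1; have r0 : 0 < r by lra.
rewrite normc_sqr; set W := norm1 w; set N := norm1 z.
have W0 : 0 <= W by exact: norm1_ge0.
have N0 : 0 <= N by exact: norm1_ge0.
have zeta : normc (cinner z (r^-1%:C *: w) / 2) <= W * N / r.
  rewrite normcM half_complex normc_real (ger0_norm (_ : 0 <= 2^-1)) ?invr_ge0//.
  rewrite cinner_scaler normcM normc_real ger0_norm ?invr_ge0 ?(ltW r0)//.
  have H : r^-1 * normc (cinner z w) <= r^-1 * (W * N).
    by rewrite ler_wpM2l ?invr_ge0 ?(ltW r0)// normc_cinner_le.
  have : 0 <= r^-1 * normc (cinner z w) by rewrite mulr_ge0 ?invr_ge0 ?(ltW r0) ?normc_ge0.
  lra.
have ri : r^-1 <= 1 by rewrite invf_le1.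
have WNr : W * N / r <= W * N by rewrite -[leRHS]mulr1 ler_wpM2l ?mulr_ge0.
have B1 : normc (fock_kernel (r^-1%:C *: w) z - 1) <= 3 * (W / r) * expR ((1 + W) * N).
  apply: le_trans (normc_cexpB1 _) _.
  rewrite [X in _ <= _ * expR X](_ : _ = N + W * N); last by ring.
  rewrite expRD.
  apply: (@le_trans _ _ (3 * (W * N / r) * expR (W * N))).
    apply: ler_pM; rewrite ?mulr_ge0 ?normc_ge0 ?expR_ge0 ?ler_wpM2l//.
    by rewrite ler_expR (le_trans zeta).
  rewrite [leLHS](_ : _ = 3 * (W / r) * (N * expR (W * N))); last by ring.
  rewrite ler_wpM2l ?mulr_ge0 ?invr_ge0 ?(ltW r0)//.
  by rewrite ler_wpM2r ?expR_ge0 ?le_expR.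
have := @lerXn2r R 2 _ _ (normc_ge0 _) _ B1.
rewrite nnegrE !mulr_ge0 ?expR_ge0 ?invr_ge0 ?(ltW r0)// => /(_ isT)/le_trans; apply.
rewrite !exprMn -expRM_natl exprVn.
rewrite [X in expR X](_ : _ = (2 + 2 * W) * N); last by ring.
by rewrite ler_wpM2r ?expR_ge0//; lra.
Qed.

(** The reproducing formula for z |-> g (r z) at the points 2w / r, w / r and 0.
    The second difference of the kernels is of order 1 / r^2 by [kernel_double],
    while g (r z) is of order r. *)
Lemma liouville_scale (w : Cn) : exists B : R, forall r : R, 1 <= r ->
  normc (((2 * pi) ^+ n)%:C * (g ((2 : R)%:C *: w) - 2 * g w)) <= B / r.
Proof.
(* total rate of exponential growth: 1 from g, 2 + 2 |w| from the kernels *)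
pose b : R := 3 + 2 * norm1 w.
pose I := \int[vol]_t (expR (- (4^-1 * csqnorm (cp t)))).
pose D := L * (9 * norm1 w ^+ 2) * expR (b ^+ 2 *+ n).
exists (2 * (D * I)) => r r1.
have r0 : 0 < r by lra.
pose f z := g (r%:C *: z).
have hf : holomorphic f.
  move=> z; apply: (@differentiable_comp _ _ _ _ (r%:C \*: idfun) g z).
    exact: differentiableZ.
  exact: g_hol.
have sf := holomorphic_sep hf.
have int_f v : cintegrable vol (fun t => f (cp t) * gauss_kernel_row v (cp t)).
  apply: (@cintegrable_exp_type _ _ _ (1 + norm1 v) (r * L)).
  - apply: cmeasurable_mul; last exact: cmeasurable_gauss_kernel.
    exact: cmeasurable_continuous_row sf.1.
  - by rewrite mulr_ge0// ltW.
  - move=> t; rewrite gauss_kernel_rowE !normcM normc_conj normc_real.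
    rewrite (ger0_norm (gaussian_ge0 _)) mulrA mulrDl mul1r expRD !mulrA.
    rewrite ler_wpM2r ?gaussian_ge0// ler_pM ?normc_ge0//.
      exact: growth_linear.
    exact: normc_fock_kernel_le.
pose u : Cn := r^-1%:C *: w.
have fu : f u = g w.
  by rewrite /f /u scalerA -rmorphM mulfV ?gt_eqF// scale1r.
have f2u : f ((2 : R)%:C *: u) = g ((2 : R)%:C *: w).
  by rewrite /f /u !scalerA -!rmorphM mulrAC mulfV ?gt_eqF// mul1r.
have f0 : f 0 = 0 by rewrite /f scaler0 g0.
have E : ((2 * pi) ^+ n)%:C * (g ((2 : R)%:C *: w) - 2 * g w) =
  cintegral vol (fun t => f (cp t) * (gauss_kernel_row ((2 : R)%:C *: u) (cp t) -
    2 * gauss_kernel_row u (cp t) + gauss_kernel_row 0 (cp t))).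
  have i2 := cintegrable_scale (-2) (int_f u).
  rewrite (eq_cintegral _ (g := fun t =>
    (f (cp t) * gauss_kernel_row ((2 : R)%:C *: u) (cp t) +
    -2 * (f (cp t) * gauss_kernel_row u (cp t))) +
    f (cp t) * gauss_kernel_row 0 (cp t))); last by move=> t; ring.
  rewrite cintegral_add//; last exact: cintegrable_add.
  rewrite cintegral_add// cintegral_scale// !reproducing_row// fu f2u f0.
  ring.
have int_E : cintegrable vol (fun t => f (cp t) * (gauss_kernel_row ((2 : R)%:C *: u) (cp t) -
    2 * gauss_kernel_row u (cp t) + gauss_kernel_row 0 (cp t))).
  apply: eq_cintegrable (cintegrable_add (cintegrable_add (int_f (2%:C *: u))
    (cintegrable_scale (-2) (int_f u))) (int_f 0)) => t; ring.
rewrite E.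
have gi := @integrable_gauss_volume R n 4^-1 ltac:(by rewrite invr_gt0).
apply: le_trans.
  apply: (normc_cintegral_le int_E (integrable_scaleR (D / r) measurableT gi)) => t.
  rewrite kernel_double !normcM normc_conj normc_real (ger0_norm (gaussian_ge0 _)).
  have H1 := growth_linear (cp t) r1.
  have H2 := normc_kernel_double w (cp t) r1.
  have H3 := ler_pM (normc_ge0 _) (normc_ge0 _) H1 H2.
  rewrite mulrA; apply: le_trans (ler_wpM2r (gaussian_ge0 _) H3) _.
  have := expR_norm1_gaussian b (cp t).
  rewrite (_ : b * _ = norm1 (cp t) + (2 + 2 * norm1 w) * norm1 (cp t)); last first.
    by rewrite /b; ring.
  rewrite expRD => H4.
  have Lr0 : 0 <= L * (9 * norm1 w ^+ 2) / r.
    by rewrite !mulr_ge0 ?invr_ge0 ?(ltW r0) ?norm1_ge0.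
  have := ler_wpM2l Lr0 H4.
  rewrite /D; congr (_ <= _); last by ring.
  by field; rewrite gt_eqF.
rewrite RintegralZl// le_eqVlt; apply/orP; left; apply/eqP; rewrite /I; ring.
Qed.

Lemma liouville_double (w : Cn) : g ((2 : R)%:C *: w) = 2 * g w.
Proof.
have [B HB] := liouville_scale w.
apply/eqP; rewrite -subr_eq0; apply/eqP/eq0_normc.
set x := normc _; have x0 : 0 <= x by exact: normc_ge0.
have B0 : 0 <= B by have := HB 1 (lexx _); rewrite divr1; apply: le_trans; exact: normc_ge0.
pose c := (2 * pi) ^+ n : R.
have c0 : 0 < c by rewrite exprn_gt0// mulr_gt0// pi_gt0.
apply/eqP; rewrite eq_le x0 andbT leNgt; apply/negP => xgt.
have cx : 0 < c * x by rewrite mulr_gt0.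
pose r := 1 + B / (c * x).
have r1 : 1 <= r by rewrite /r lerDl divr_ge0// ltW.
have := HB r r1; rewrite normcM normc_real ger0_norm ?(ltW c0)// -/x -/c.
rewrite ler_pdivlMr; last by lra.
rewrite /r mulrDr mulr1 mulrCA mulfV ?gt_eqF// mulr1; lra.
Qed.

(** By doubling, g w is 2^k g (w / 2^k), which tends to the derivative of g at 0
    in the direction w. *)
Lemma liouville_linear (w : Cn) : g w = 'd g 0 w.
Proof.
have pow k : g w = 2 ^+ k * g ((2^-1 ^+ k)%:C *: w).
  elim: k => [|k IH]; first by rewrite !expr0 mul1r scale1r.
  rewrite IH exprS [2 * _]mulrC -mulrA -liouville_double.
  congr (_ * g _); rewrite scalerA -rmorphM exprS mulrA mulfV// mul1r.
  by [].
have H := holomorphic_line 0 w 0 g_hol.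
apply/eqP; rewrite -subr_eq0; apply/eqP/eq0_normc/eqP; rewrite eq_le normc_ge0 andbT.
apply/ler_addgt0Pl => e e0; rewrite addr0.
have [r r0 Hr] := H e e0.
have [k kr] : exists k, (2^-1 : R) ^+ k < r.
  exists (Num.bound r^-1); rewrite exprVn -[ltRHS]invrK ltf_pV2 ?posrE ?invr_gt0 ?exprn_gt0//.
  apply: lt_trans (archi_boundP _) _; first by rewrite invr_ge0 ltW.
  by rewrite -natrX ltr_nat ltn_expl.
pose a : C := (2^-1 ^+ k)%:C.
have an : normc a = 2^-1 ^+ k by rewrite normc_real ger0_norm// exprn_ge0// invr_ge0.
have := Hr a; rewrite subr0 an => /(_ kr).
rewrite !scale0r !add0r !g0 mul0r addr0 subr0 => Ha.
have E : g w - 'd g 0 w = 2 ^+ k * (g (a *: w) - 'd g 0 w * a).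
  rewrite mulrBr -pow; congr (_ - _); have aE : a = 2^-1 ^+ k by rewrite half_complex -rmorphXn.
  by rewrite mulrCA aE -exprMn mulfV// expr1n mulr1.
rewrite E normcM.
have -> : normc ((2 : C) ^+ k) = 2 ^+ k.
  have -> : (2 : C) ^+ k = (2 ^+ k)%:C by rewrite rmorphXn rmorph_nat.
  by rewrite normc_real ger0_norm// exprn_ge0.
apply: le_trans (ler_wpM2l _ Ha) _; first by rewrite exprn_ge0.
by rewrite mulrCA -exprMn mulfV// expr1n mulr1.
Qed.

End liouville.

(** * A matrix criterion for normality *)

Section normal_matrices.
Variables (R : realType) (n : nat).
Local Notation C := R[i].
Local Notation Cn := 'rV[R[i]]_n.
Implicit Types (u v w z : Cn) (A : 'M[C]_n).

Definition adjoint_mx A : 'M[C]_n := \matrix_(i, j) conjc (A j i).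

Lemma cinner_mulmx A z w : cinner (z *m A) w = cinner z (w *m adjoint_mx A).
Proof.
rewrite /cinner; under eq_bigr do rewrite mxE mulr_suml.
rewrite exchange_big /=; apply: eq_bigr => i _.
rewrite mxE rmorph_sum mulr_sumr; apply: eq_bigr => j _.
by rewrite mxE /= conjcM conjcK; ring.
Qed.

Lemma cinnerDl u v w : cinner (u + v) w = cinner u w + cinner v w.
Proof.
by rewrite /cinner -big_split; apply: eq_bigr => j _; rewrite mxE mulrDl.
Qed.

Lemma cinnerZl (c : C) u w : cinner (c *: u) w = c * cinner u w.
Proof.
by rewrite /cinner mulr_sumr; apply: eq_bigr => j _; rewrite mxE mulrA.
Qed.

Lemma cinnerDr u v w : cinner w (u + v) = cinner w u + cinner w v.
Proof. by rewrite -!(conj_cinner _ w) cinnerDl rmorphD. Qed.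

Lemma cinnerZr (c : C) u w : cinner w (c *: u) = conjc c * cinner w u.
Proof. by rewrite -!(conj_cinner _ w) cinnerZl conjcM. Qed.

(** With B the adjoint of A, the Hermitian form s (u, v) = <u B, v B> - <u A, v A> is positive, and its
    trace is the difference of the sums of the squared moduli of the entries of B
    and of A, which is zero. A positive Hermitian form of trace zero vanishes. *)
Lemma normal_of_csqnorm_le A :
  (forall w, csqnorm (w *m A) <= csqnorm (w *m adjoint_mx A)) ->
  A *m adjoint_mx A = adjoint_mx A *m A.
Proof.
set B := adjoint_mx A => AB.
pose s u v := cinner (u *m B) (v *m B) - cinner (u *m A) (v *m A).
pose e i : Cn := delta_mx ord0 i.
have sC u v : conjc (s u v) = s v u by rewrite /s rmorphB /= !conj_cinner.
have s_ge0 u : 0 <= complex.Re (s u u).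
  by rewrite /s !csqnorm_cinner -rmorphB /= subr_ge0.
have s_real u : s u u = (complex.Re (s u u))%:C.
  by rewrite /s !csqnorm_cinner -rmorphB.
have see : \sum_i complex.Re (s (e i) (e i)) = 0.
  have E (M : 'M[C]_n) i : csqnorm (e i *m M) = \sum_j normc (M i j) ^+ 2.
    by apply: eq_bigr => j _; rewrite -rowE mxE.
  under eq_bigr do rewrite /s !csqnorm_cinner -rmorphB /= !E.
  rewrite sumrB exchange_big /=; apply/eqP; rewrite subr_eq0; apply/eqP.
  by apply: eq_bigr => i _; apply: eq_bigr => j _; rewrite mxE normc_conj.
have sii i : s (e i) (e i) = 0.
  rewrite s_real; have /eqP := see; rewrite psumr_eq0// => /allP/(_ i (mem_index_enum _)).
  by move=> /eqP ->.
have sDl u v w : s (u + v) w = s u w + s v w.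
  by rewrite /s !mulmxDl !cinnerDl; ring.
have sZl c u w : s (c *: u) w = c * s u w.
  by rewrite /s -!scalemxAl !cinnerZl; ring.
have sDr u v w : s w (u + v) = s w u + s w v.
  by rewrite /s !mulmxDl !cinnerDr; ring.
have sZr c u w : s w (c *: u) = conjc c * s w u.
  by rewrite /s -!scalemxAl !cinnerZr; ring.
have sij i j : s (e i) (e j) = 0.
  (* as s vanishes at (e_i, e_i) and (e_j, e_j), its value at this vector is
     - 2 |s (e_i, e_j)|^2 *)
  have := s_ge0 (e i + (- s (e i) (e j)) *: e j).
  rewrite sDl !sDr !sZl !sZr !sii -(sC (e i) (e j)) !mulr0 addr0 add0r.
  move: (s (e i) (e j)) => y; rewrite !ReImE => H.
  have : normc y ^+ 2 <= 0 by rewrite sqr_normc; nra.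
  move=> y0; apply/eq0_normc/eqP; rewrite -sqrf_eq0 eq_le y0; exact: sqr_ge0.
apply/esym/matrixP => i j; apply/eqP; rewrite -subr_eq0 -(sij i j) /s.
apply/eqP; congr (_ - _); rewrite /cinner mxE; apply: eq_bigr => k _.
  by rewrite /e -!rowE !mxE conjcK.
by rewrite /e -!rowE !mxE.
Qed.

End normal_matrices.

(** * Hyponormal composition operators *)

Section composition_operators.
Variables (R : realType) (n : nat) (phi : 'rV[R[i]]_n -> 'rV[R[i]]_n).
Local Notation C := R[i].
Local Notation Cn := 'rV[R[i]]_n.
Implicit Types (w z : Cn) (f : Cn -> C).
Variable S : (Cn -> C) -> (Cn -> C).
Hypothesis phi_hol : holomorphic_map phi.
Hypothesis T_fock : forall f, fock f -> fock (composition phi f).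
Hypothesis S_adj : is_adjoint (composition phi) S.

(** The adjoint is evaluated at w by pairing with the kernel at w, which passes to
    the other side of the inner product as its composition with phi. *)
Lemma adjointE f w : fock f ->
  S f w = conjc (fock_dot (composition phi (fock_kernel w)) f).
Proof.
move=> ff; have [fS adj] := S_adj.
rewrite adj//; last exact: fock_kernel_fock.
rewrite -fock_dot_conj//; [|exact: fock_kernel_fock|exact: fS].
by rewrite fock_reproducing//; exact: fS.
Qed.

Lemma adjoint_fock_kernel w : S (fock_kernel w) = fock_kernel (phi w).
Proof.
apply/funext => z; rewrite adjointE; last exact: fock_kernel_fock.
rewrite fock_reproducing; last by apply: T_fock; exact: fock_kernel_fock.
exact: conj_fock_kernel.
Qed.

Hypothesis hyp : forall f, fock f -> fock_norm (S f) <= fock_norm (composition phi f).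

(** The kernel at 0 is the constant 1. It is fixed by composition, while its image
    under the adjoint is the kernel at phi 0, whose norm exceeds 1 unless
    phi 0 = 0. *)
Lemma phi_zero : phi 0 = 0.
Proof.
have := hyp (fock_kernel_fock 0); rewrite adjoint_fock_kernel.
have -> : composition phi (fock_kernel 0) = fock_kernel 0.
  by apply/funext => z; rewrite /composition /= !fock_kernel0.
rewrite !fock_norm_kernel ler_expR ler_pM2r ?invr_gt0// => H.
have c0 : csqnorm (0 : Cn) = 0.
  by rewrite /csqnorm big1// => j _; rewrite mxE normc0 expr0n.
apply/rowP => j; rewrite mxE; apply: eq0_normc; apply/eqP.
rewrite -sqrf_eq0 eq_le sqr_ge0 andbT -c0; apply: le_trans H.
by rewrite /csqnorm (bigD1 j)//= lerDl; apply: sumr_ge0 => i _; exact: sqr_ge0.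
Qed.

Variable M : R.
Hypothesis T_bounded : forall f, fock f ->
  fock_norm (composition phi f) <= M * fock_norm f.

(** The norm of the kernel at phi w is at most M <= exp |M| times that of the
    kernel at w; comparing exponents gives the bound. *)
Lemma phi_growth w : csqnorm (phi w) <= csqnorm w + 4 * `|M|.
Proof.
have fw := fock_kernel_fock w.
have := le_trans (hyp fw) (T_bounded fw).
rewrite adjoint_fock_kernel !fock_norm_kernel => H.
have : expR (csqnorm (phi w) / 4) <= expR (`|M|) * expR (csqnorm w / 4).
  apply: le_trans H _; rewrite ler_wpM2r ?expR_ge0//.
  exact: le_trans (ler_norm _) (le_expR _).
by rewrite -expRD ler_expR; lra.
Qed.

Definition phi_mx : 'M[C]_n := \matrix_(i, j) phi (delta_mx ord0 i) ord0 j.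

Lemma phi_linear z : phi z = z *m phi_mx.
Proof.
apply/rowP => j; pose g w : C := phi w ord0 j.
have gh : holomorphic g.
  move=> w; apply: (@differentiable_comp _ _ _ _ phi (fun N : Cn => N ord0 j : C)).
    exact: phi_hol.
  exact: differentiable_coord.
have g_growth w : normc (g w) ^+ 2 <= csqnorm w + 4 * `|M|.
  apply: le_trans (phi_growth w).
  by rewrite /csqnorm (bigD1 j)//= lerDl; apply: sumr_ge0 => i _; exact: sqr_ge0.
have M0 : 0 <= 4 * `|M| by rewrite mulr_ge0.
have g0 : g 0 = 0 by rewrite /g phi_zero mxE.
have gE := liouville_linear gh M0 g_growth g0.
rewrite -/(g z) gE {1}[z]row_sum_delta linear_sum /= mxE.
by apply: eq_bigr => i _; rewrite linearZ /= -gE mxE.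
Qed.

Lemma composition_fock_kernel w :
  composition phi (fock_kernel w) = fock_kernel (w *m adjoint_mx phi_mx).
Proof.
apply/funext => z; rewrite /composition /= /fock_kernel phi_linear.
by rewrite cinner_mulmx.
Qed.

(** On the kernel at w, hyponormality compares the norms of the kernels at
    [w *m phi_mx] and [w *m adjoint_mx phi_mx]. *)
Lemma phi_mx_normal : phi_mx *m adjoint_mx phi_mx = adjoint_mx phi_mx *m phi_mx.
Proof.
apply: normal_of_csqnorm_le => w; have := hyp (fock_kernel_fock w).
rewrite adjoint_fock_kernel composition_fock_kernel !fock_norm_kernel.
by rewrite ler_expR ler_pM2r ?invr_gt0// phi_linear.
Qed.

Lemma adjoint_composition f w : fock f -> S f w = f (w *m adjoint_mx phi_mx).
Proof.
move=> ff; rewrite adjointE// composition_fock_kernel.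
by rewrite -fock_dot_conj ?fock_reproducing//; exact: fock_kernel_fock.
Qed.

Lemma adjoint_commutes f : fock f -> S (composition phi f) = composition phi (S f).
Proof.
move=> ff; apply/funext => w; rewrite adjoint_composition; last exact: T_fock.
rewrite /composition /= adjoint_composition// !phi_linear -!mulmxA.
by rewrite phi_mx_normal.
Qed.

End composition_operators.

Theorem proposition3p2 (R : realType) (n : nat) (hn : (1 <= n)%N)
    (phi : 'rV[R[i]]_n -> 'rV[R[i]]_n) :
  holomorphic_map phi ->
  bounded_on_fock (composition phi) ->
  hyponormal_on_fock (composition phi) ->
  normal_on_fock (composition phi).
Proof.
move=> phi_hol [T_fock _ [M T_bounded]] [S S_adj hyp]; exists S => // f ff.
exact: (adjoint_commutes phi_hol T_fock S_adj hyp T_bounded ff).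
Qed.
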